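(* Let $\triangle PQR$ be a triangle contained in $D$ with $\rho(\psi_{\triangle PQR})=\frac13$; write $\psi=\psi_{\triangle PQR}$. (1) If $\delta(P,Q,R)=\Delta'(P,Q)$: there exists $u_1\in S^1$ with $\psi^3(u_1)=u_1$ such that, setting $u_2=\psi(u_1)$, $u_3=\psi^2(u_1)$, $I_1=\mathrm{arc}(u_3u_1)\setminus\{u_3\}$ and $I_j=\mathrm{arc}(u_{j-1}u_j)\setminus\{u_{j-1}\}$ for $j=2,3$, we have $\lim_{n\to\infty}\psi^{3n}(v)=u_j$ for every $j\in\{1,2,3\}$ and every $v\in I_j$. (2) If $\delta(P,Q,R)>\Delta'(P,Q)$: there exist $u_1\in S^1$ with $\psi^3(u_1)=u_1$ and, with $u_2=\psi(u_1)$, $u_3=\psi^2(u_1)$, a point $v_1\in\mathrm{arc}(u_1u_2)\setminus\{u_1,u_2\}$ with $\psi^3(v_1)=v_1$, such that, setting $v_2=\psi(v_1)$, $v_3=\psi^2(v_1)$, $I_1'=\mathrm{arc}(v_3v_1)\setminus\{v_3,v_1\}$ and $I_j'=\mathrm{arc}(v_{j-1}v_j)\setminus\{v_{j-1},v_j\}$ for $j=2,3$, we have $\lim_{n\to\infty}\psi^{3n}(v)=u_j$ for every $j\in\{1,2,3\}$ and every $v\in I_j'$.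
   Context: $D$ is the open unit disk in $\mathbb{R}^2$ (Beltrami–Klein model) and $S^1$ its boundary, identified with $\mathbb{R}/\mathbb{Z}$ via $t\mapsto(\cos2\pi t,\sin2\pi t)$. For $u,v\in S^1$, $\mathrm{arc}(uv)$ is the closed arc of $S^1$ going counterclockwise from $u$ to $v$. For $P,Q\in D$ with chord endpoints $v_1,v_2\in S^1$, $d'(P,Q)=\frac12\left|\log\frac{|v_1Q||v_2P|}{|v_1P||v_2Q|}\right|$, $\Delta'(P,Q)=\log\frac{e^{d'(P,Q)}+1}{e^{d'(P,Q)}-1}$, and $\delta(P,Q,R)$ is the minimum of $d'(R,S)$ over points $S\in D$ on the line $PQ$. For a (non-degenerate, closed) triangle $\triangle PQR\subset D$ and $v\in S^1$, there are exactly two chords $vv_1,vv_2$ of $S^1$ whose lines support $\triangle PQR$; with $v_1$ the one reached first moving counterclockwise from $v$, set $\psi_{\triangle PQR}(v):=v_1$ (a homeomorphism of $S^1$). $\rho(\psi_{\triangle PQR})=\lim_{n\to\infty}\overline{\psi}^{\,n}(0)/n$ is its rotation number, where $\overline{\psi}$ is the lift to $\mathbb{R}$ with $\overline{\psi}(0)\in(0,1)$. *)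

(* Defs.v *)
From Stdlib Require Import Reals Lra.
From Coquelicot Require Import Coquelicot.
Open Scope R_scope.

Definition pt := (R * R)%type.

Definition dist (X Y : pt) : R :=
  sqrt ((fst X - fst Y)^2 + (snd X - snd Y)^2).

Definition inD (X : pt) : Prop := (fst X)^2 + (snd X)^2 < 1.
Definition onS1 (X : pt) : Prop := (fst X)^2 + (snd X)^2 = 1.

Definition e (t : R) : pt := (cos (2 * PI * t), sin (2 * PI * t)).

(* x lies on arc(uv): the closed arc of S^1 going counterclockwise
   from u to v (arc(uu) = {u}). *)
Definition in_arc (u v x : pt) : Prop :=
  exists a d s, u = e a /\ v = e (a + d) /\ x = e (a + s) /\
                0 <= s <= d /\ d < 1.

Definition cross (O X Y : pt) : R :=
  (fst X - fst O) * (snd Y - snd O) - (snd X - snd O) * (fst Y - fst O).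
Definition noncollinear (P Q R0 : pt) : Prop := cross P Q R0 <> 0.

(* The line through v and w (v <> w) supports the closed triangle PQR:
   the triangle lies in one closed half-plane of the line and meets it
   (for a convex polygon, the line then touches a vertex). *)
Definition supports (P Q R0 v w : pt) : Prop :=
  ((0 <= cross v w P /\ 0 <= cross v w Q /\ 0 <= cross v w R0) \/
   (cross v w P <= 0 /\ cross v w Q <= 0 /\ cross v w R0 <= 0)) /\
  (cross v w P = 0 \/ cross v w Q = 0 \/ cross v w R0 = 0).

(* w = psi_{PQR}(v): w is the endpoint (other than v) of a chord vw of S^1
   whose line supports the triangle, and it is the first such endpoint
   reached moving counterclockwise from v. *)
Definition is_psi (P Q R0 v w : pt) : Prop :=
  onS1 w /\ w <> v /\ supports P Q R0 v w /\
  forall w', onS1 w' -> w' <> v -> supports P Q R0 v w' -> in_arc v w' w.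

Definition rotation_number_is (psi : pt -> pt) (r : R) : Prop :=
  exists F : R -> R,
    continuity F /\ (forall t, e (F t) = psi (e t)) /\ 0 < F 0 < 1 /\
    is_lim_seq (fun n => Nat.iter n F 0 / INR n) r.

(* Endpoints v1, v2 of the chord of S^1 through P and Q (P <> Q, P in D). *)
Definition chord_end (sgn : R) (P Q : pt) : pt :=
  let dx := fst Q - fst P in
  let dy := snd Q - snd P in
  let a := dx^2 + dy^2 in
  let b := fst P * dx + snd P * dy in
  let c := (fst P)^2 + (snd P)^2 - 1 in
  let t := (- b + sgn * sqrt (b^2 - a * c)) / a in
  (fst P + t * dx, snd P + t * dy).

Definition dprime (P Q : pt) : R :=
  if Req_EM_T (dist P Q) 0 then 0 else
  let v1 := chord_end 1 P Q in
  let v2 := chord_end (-1) P Q in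
  / 2 * Rabs (ln ((dist v1 Q * dist v2 P) / (dist v1 P * dist v2 Q))).

Definition Deltaprime (P Q : pt) : R :=
  ln ((exp (dprime P Q) + 1) / (exp (dprime P Q) - 1)).

Definition on_line (P Q S : pt) : Prop :=
  exists t, S = (fst P + t * (fst Q - fst P), snd P + t * (snd Q - snd P)).
Definition is_delta (P Q R0 : pt) (m : R) : Prop :=
  (exists S, inD S /\ on_line P Q S /\ dprime R0 S = m) /\
  (forall S, inD S -> on_line P Q S -> m <= dprime R0 S).

Definition conv3 (psi : pt -> pt) (v u : pt) : Prop :=
  is_lim_seq (fun n => fst (Nat.iter (3 * n) psi v)) (fst u) /\
  is_lim_seq (fun n => snd (Nat.iter (3 * n) psi v)) (snd u).

(* Main.v *)
Require Import Defs.
From Stdlib Require Import Reals Lra Lia ZArith.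
From Coquelicot Require Import Coquelicot.
Open Scope R_scope.

(** Write a point [e t] of the circle as the direction [half t = (cos (pi t), sin (pi t))].
    The chord through [e a] and [e b] passes through [X] iff [half a] and [half b] are
    orthogonal for a positive definite form [bil X], so the involution of the circle
    through [X] is the half-turn [turn X] acting on directions, and the lift [F] of [psi]
    is the minimum of the lifts of the three involutions. Rotation number 1/3 gives a
    point with [F^3 t = t + 1]. The corresponding inscribed triangle has exactly one
    vertex of [PQR] on each side, so near the orbit [F^3] is the composition of the three
    half-turns, and every orbit of period 3 contains a fixed direction of that
    composition, i.e. a zero of the quadratic form [qform]. Its discriminant is
    [4 (cross^2 - (1-|P|^2)(1-|Q|^2)(1-|R|^2))], while the hyperbolic formulas for
    [dprime] show that [delta = Deltaprime], resp. [delta > Deltaprime], means that it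
    vanishes, resp. is positive. If it vanishes there is only one orbit, and [qform] is
    negative at its second point, so all other points move counterclockwise under
    [F^3 - 1]. If it is positive, [F^3 t - t - 1] changes sign at the orbit, the
    intermediate value theorem gives a second orbit, and there is no third one. *)

(** * Hyperbolic distances and the area of the triangle *)

Definition normdef (X : pt) : R := 1 - (fst X)^2 - (snd X)^2.

(* [sep X Y / (normdef X * normdef Y)] is [sinh^2] of the hyperbolic distance. *)
Definition sep (X Y : pt) : R :=
  (fst X - fst Y)^2 + (snd X - snd Y)^2 - (fst X * snd Y - snd X * fst Y)^2.

Lemma sum_sq_sub_pos (x y z w : R) : (x, y) <> (z, w) -> 0 < (z - x)^2 + (w - y)^2.
Proof.
intros HN.
destruct (Req_dec z x) as [->|H1].
- assert (H : w - y <> 0) by (intros H; apply HN; f_equal; lra).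
  pose proof (pow2_gt_0 (w - y) H). pose proof (pow2_ge_0 (x - x)). lra.
- assert (H : z - x <> 0) by lra.
  pose proof (pow2_gt_0 (z - x) H). pose proof (pow2_ge_0 (w - y)). lra.
Qed.

(** By Lagrange's identity [sep X Y] is (X.(Y-X))^2 + |Y-X|^2 (1-|X|^2). *)
Lemma sep_pos (X Y : pt) : inD X -> X <> Y -> 0 < sep X Y.
Proof.
unfold inD, sep; destruct X as [x y], Y as [z w]; simpl fst; simpl snd.
intros HX HN.
pose proof (sum_sq_sub_pos x y z w HN) as Hd.
replace ((x - z)^2 + (y - w)^2 - (x * w - y * z)^2)
  with ((x * (z - x) + y * (w - y))^2
        + ((z - x)^2 + (w - y)^2) * (1 - (x^2 + y^2))) by ring.
assert (0 < ((z - x)^2 + (w - y)^2) * (1 - (x^2 + y^2)))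
  by (apply Rmult_lt_0_compat; lra).
pose proof (pow2_ge_0 (x * (z - x) + y * (w - y))); lra.
Qed.

Lemma dist_along (x y dx dy s t : R) :
  Defs.dist (x + s * dx, y + s * dy) (x + t * dx, y + t * dy)
  = Rabs (s - t) * sqrt (dx^2 + dy^2).
Proof.
unfold Defs.dist; simpl fst; simpl snd.
replace ((x + s * dx - (x + t * dx))^2 + (y + s * dy - (y + t * dy))^2)
  with ((s - t)^2 * (dx^2 + dy^2)) by ring.
rewrite sqrt_mult; [|apply pow2_ge_0|nra].
f_equal. replace ((s - t)^2) with (Rsqr (s - t)) by (unfold Rsqr; ring).
apply sqrt_Rsqr_abs.
Qed.

Lemma dprime_ge0 (X Y : pt) : 0 <= dprime X Y.
Proof.
unfold dprime; destruct Req_EM_T; [lra|].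
apply Rmult_le_pos; [lra|apply Rabs_pos].
Qed.

(** Since sinh^2 x = (cosh 2x - 1)/2 and cosh is even, the absolute value disappears. *)
Lemma sinh_half_ln (r : R) : 0 < r ->
  sinh (/ 2 * Rabs (ln r)) ^ 2 = (r - 1)^2 / (4 * r).
Proof.
intros Hr.
assert (H : forall x, sinh x ^ 2 = (exp (2 * x) + exp (- (2 * x)) - 2) / 4).
{ intros x; unfold sinh.
  replace (- (2 * x)) with (- x + - x) by ring.
  replace (2 * x) with (x + x) by ring.
  rewrite !exp_plus.
  assert (exp x * exp (- x) = 1) by (rewrite <- exp_plus, Rplus_opp_r; apply exp_0).
  nra. }
rewrite H.
replace (2 * (/ 2 * Rabs (ln r))) with (Rabs (ln r)) by field.
unfold Rabs; destruct Rcase_abs; rewrite ?Ropp_involutive, exp_Ropp, exp_ln by lra;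
  field; lra.
Qed.

(* With [v1 = X + t1 (Y - X)] and [v2 = X + t2 (Y - X)] the numbers [t1], [t2] are
   the roots of a quadratic, and the cross ratio is a rational function of them. *)
Lemma sinh_dprime_sq (X Y : pt) : inD X -> inD Y ->
  sinh (dprime X Y) ^ 2 = sep X Y / (normdef X * normdef Y).
Proof.
intros HX HY.
unfold dprime; destruct (Req_EM_T (Defs.dist X Y) 0) as [H0|H0].
(* [dprime] is 0 by convention at coinciding points, where [sep] vanishes as well. *)
{ rewrite sinh_0. destruct X as [x y], Y as [z w].
  unfold Defs.dist in H0; simpl in H0.
  apply sqrt_eq_0 in H0;
    [|pose proof (pow2_ge_0 (x - z)); pose proof (pow2_ge_0 (y - w)); simpl in *; lra].
  destruct (Rplus_sqr_eq_0 (x - z) (y - w)); [unfold Rsqr; lra|].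
  assert (x = z) as -> by lra. assert (y = w) as -> by lra.
  unfold sep; simpl. unfold Rdiv. ring. }
assert (HN : X <> Y).
{ intros ->. apply H0. unfold Defs.dist.
  replace ((fst Y - fst Y)^2 + (snd Y - snd Y)^2) with 0 by ring. apply sqrt_0. }
pose proof (sep_pos X Y HX HN) as HS.
destruct X as [x y], Y as [z w].
unfold chord_end; unfold inD in *; simpl fst in *; simpl snd in *.
set (dx := z - x) in *. set (dy := w - y) in *.
pose proof (sum_sq_sub_pos x y z w HN) as Ha; fold dx dy in Ha.
set (b := x * dx + y * dy). set (a := dx^2 + dy^2) in *.
set (c := x^2 + y^2 - 1).
(* [sep] is the reduced discriminant of the quadratic that cuts the circle with the line. *)
assert (HD : b^2 - a * c = sep (x, y) (z, w)).
{ unfold b, a, c, dx, dy, sep; simpl; ring. }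
set (D := sqrt (b^2 - a * c)).
assert (HD2 : D * D = b^2 - a * c) by (apply sqrt_sqrt; lra).
assert (HDp : 0 < D) by (apply sqrt_lt_R0; lra).
set (t1 := (- b + 1 * D) / a). set (t2 := (- b + -1 * D) / a).
assert (Hsum : t1 + t2 = - 2 * b / a) by (unfold t1, t2; field; lra).
assert (Hprod : t1 * t2 = c / a).
{ unfold t1, t2. replace ((- b + 1 * D) / a * ((- b + -1 * D) / a))
    with ((b^2 - D * D) / (a * a)) by (field; lra).
  rewrite HD2. field; lra. }
assert (Hdiff : t1 - t2 = 2 * D / a) by (unfold t1, t2; field; lra).
(* This is the power of the point Y with respect to the circle, divided by [a]. *)
assert (Hprod1 : (t1 - 1) * (1 - t2) = normdef (z, w) / a).
{ replace ((t1 - 1) * (1 - t2)) with (t1 + t2 - t1 * t2 - 1) by ring.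
  rewrite Hsum, Hprod. unfold normdef; simpl.
  replace (1 - z * (z * 1) - w * (w * 1)) with (- 2 * b - c - a)
    by (unfold a, b, c, dx, dy; ring).
  field; lra. }
assert (Hc : c < 0) by (unfold c; lra).
assert (Hca : t1 * t2 < 0).
{ rewrite Hprod. apply Rdiv_neg_pos; lra. }
assert (Hq : 0 < (t1 - 1) * (1 - t2)).
{ rewrite Hprod1. apply Rdiv_lt_0_compat; [|lra]. unfold normdef; simpl in *; lra. }
(* The signs of the two products now give t2 < 0 and 1 < t1, which removes the absolute values. *)
assert (H21 : t2 < t1).
{ assert (0 < 2 * D / a) by (apply Rdiv_lt_0_compat; lra). lra. }
assert (Ht2 : t2 < 0) by nra.
assert (Ht1 : 1 < t1) by nra.
replace (z, w) with (x + 1 * dx, y + 1 * dy) by (unfold dx, dy; f_equal; ring).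
replace (Defs.dist (x + t2 * dx, y + t2 * dy) (x, y))
  with (Defs.dist (x + t2 * dx, y + t2 * dy) (x + 0 * dx, y + 0 * dy))
  by (do 2 f_equal; ring).
replace (Defs.dist (x + t1 * dx, y + t1 * dy) (x, y))
  with (Defs.dist (x + t1 * dx, y + t1 * dy) (x + 0 * dx, y + 0 * dy))
  by (do 2 f_equal; ring).
rewrite !dist_along. fold a.
replace (x + 1 * dx, y + 1 * dy) with (z, w) by (unfold dx, dy; f_equal; ring).
assert (Hs : 0 < sqrt a) by (apply sqrt_lt_R0; lra).
rewrite (Rabs_pos_eq (t1 - 1)), (Rabs_pos_eq (t1 - 0)) by lra.
rewrite (Rabs_left (t2 - 0)), (Rabs_left (t2 - 1)) by lra.
replace ((t1 - 1) * sqrt a * (- (t2 - 0) * sqrt a) /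
     ((t1 - 0) * sqrt a * (- (t2 - 1) * sqrt a)))
  with ((t1 - 1) * (- t2) / (t1 * (1 - t2))) by (field; lra).
rewrite sinh_half_ln.
2:{ apply Rdiv_lt_0_compat; apply Rmult_lt_0_compat; lra. }
replace (((t1 - 1) * - t2 / (t1 * (1 - t2)) - 1) ^ 2 /
  (4 * ((t1 - 1) * - t2 / (t1 * (1 - t2)))))
  with ((t1 - t2)^2 / (4 * (- (t1 * t2)) * ((t1 - 1) * (1 - t2)))) by (field; lra).
rewrite Hprod1, Hprod, Hdiff.
replace ((2 * D / a) ^ 2) with (4 * (D * D) / (a * a)) by (field; lra).
rewrite HD2, HD.
assert (normdef (x, y) = - c) as -> by (unfold normdef, c; simpl; ring).
assert (0 < normdef (z, w)) by (unfold normdef; simpl in *; lra).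
field; lra.
Qed.

Lemma dprime_pos (X Y : pt) : inD X -> inD Y -> X <> Y -> 0 < dprime X Y.
Proof.
intros HX HY HN.
destruct (dprime_ge0 X Y) as [H|H]; [exact H|exfalso].
pose proof (sinh_dprime_sq X Y HX HY) as HS.
rewrite <- H, sinh_0 in HS.
assert (0 < sep X Y / (normdef X * normdef Y)); [|lra].
apply Rdiv_lt_0_compat; [now apply sep_pos|].
unfold normdef, inD in *; apply Rmult_lt_0_compat; lra.
Qed.

(** With u = exp d' both hyperbolic sines are rational in u: (u^2-1)/(2u) and its inverse. *)
Lemma Deltaprime_spec (X Y : pt) : 0 < dprime X Y ->
  0 < Deltaprime X Y /\ sinh (Deltaprime X Y) * sinh (dprime X Y) = 1.
Proof.
intros Hd; unfold Deltaprime, sinh.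
assert (HE : 1 < exp (dprime X Y)) by (rewrite <- exp_0; now apply exp_increasing).
rewrite (exp_Ropp (dprime X Y)).
set (u := exp (dprime X Y)) in *.
assert (Hu : 1 < (u + 1) / (u - 1)).
{ apply Rmult_lt_reg_r with (u - 1); [lra|].
  unfold Rdiv; rewrite Rmult_assoc, Rinv_l; lra. }
split; [rewrite <- ln_1; apply ln_increasing; lra|].
rewrite exp_Ropp, exp_ln by lra.
field; repeat split; try lra.
Qed.

Lemma sinh_sq_le (x y : R) : 0 <= x -> x <= y -> sinh x ^ 2 <= sinh y ^ 2.
Proof.
intros Hx Hxy.
assert (0 <= sinh x).
{ rewrite <- sinh_0. destruct Hx as [Hx|<-]; [left; now apply sinh_lt|lra]. }
assert (sinh x <= sinh y).
{ destruct Hxy as [Hxy|<-]; [left; now apply sinh_lt|lra]. }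
apply pow_incr; lra.
Qed.

Lemma sinh_sq_lt (x y : R) : 0 <= x -> x < y -> sinh x ^ 2 < sinh y ^ 2.
Proof.
intros Hx Hxy.
assert (0 <= sinh x).
{ rewrite <- sinh_0. destruct Hx as [Hx|<-]; [left; now apply sinh_lt|lra]. }
assert (sinh x < sinh y) by now apply sinh_lt.
nra.
Qed.

(** Here [sep X Y] = (1-X.Y)^2 - [normdef X * normdef Y], and 1-R0.S = [al + be * t]. The linear
    factor squared on the right is, up to scale, the numerator of the derivative of (1-R0.S)^2 /
    [normdef S], so it vanishes at the foot of the hyperbolic perpendicular. *)
Lemma sep_line_identity (P Q R0 : pt) (t : R) :
  let S := (fst P + t * (fst Q - fst P), snd P + t * (snd Q - snd P)) in
  let a := (fst Q - fst P)^2 + (snd Q - snd P)^2 in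
  let b := fst P * (fst Q - fst P) + snd P * (snd Q - snd P) in
  let al := 1 - fst R0 * fst P - snd R0 * snd P in
  let be := - (fst R0 * (fst Q - fst P) + snd R0 * (snd Q - snd P)) in
  sep R0 S * sep P Q - cross P Q R0 ^ 2 * normdef S
  = (be * normdef P + al * b - (be * b - al * a) * t)^2.
Proof. unfold sep, cross, normdef; simpl; ring. Qed.

Lemma foot_in_disk (P Q R0 : pt) : inD P -> inD Q -> inD R0 ->
  noncollinear P Q R0 ->
  exists S, inD S /\ on_line P Q S /\
    sep R0 S * sep P Q = cross P Q R0 ^ 2 * normdef S.
Proof.
intros HP HQ HR HN.
assert (HPQ : P <> Q).
{ intros ->; apply HN; unfold cross; ring. }
set (a := (fst Q - fst P)^2 + (snd Q - snd P)^2).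
set (b := fst P * (fst Q - fst P) + snd P * (snd Q - snd P)).
set (al := 1 - fst R0 * fst P - snd R0 * snd P).
set (be := - (fst R0 * (fst Q - fst P) + snd R0 * (snd Q - snd P))).
(* With d = Q - P the slope is |d|^2 minus the product of the determinants of (R0, d) and (P, d),
   each smaller than |d| in absolute value because R0 and P lie in the disk. *)
assert (Hnz : 0 < al * a - be * b).
{ unfold al, a, be, b, inD in *; destruct P as [x y], Q as [z w], R0 as [r s];
    simpl fst in *; simpl snd in *.
  set (dx := z - x). set (dy := w - y).
  pose proof (sum_sq_sub_pos x y z w HPQ) as Ha; fold dx dy in Ha.
  replace ((1 - r * x - s * y) * (dx^2 + dy^2) - - (r * dx + s * dy) * (x * dx + y * dy))
    with (dx^2 + dy^2 - (r * dy - s * dx) * (x * dy - y * dx)) by ring.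
  assert ((r * dy - s * dx)^2 < dx^2 + dy^2).
  { replace ((r * dy - s * dx)^2) with ((r^2 + s^2) * (dx^2 + dy^2) - (r * dx + s * dy)^2)
      by ring. pose proof (pow2_ge_0 (r * dx + s * dy)). nra. }
  assert ((x * dy - y * dx)^2 < dx^2 + dy^2).
  { replace ((x * dy - y * dx)^2) with ((x^2 + y^2) * (dx^2 + dy^2) - (x * dx + y * dy)^2)
      by ring. pose proof (pow2_ge_0 (x * dx + y * dy)). nra. }
  pose proof (pow2_ge_0 ((r * dy - s * dx) - (x * dy - y * dx))). nra. }
(* The zero of the linear factor, that is, the foot of the perpendicular. *)
set (t := (be * normdef P + al * b) / (be * b - al * a)).
set (S := (fst P + t * (fst Q - fst P), snd P + t * (snd Q - snd P))).
pose proof (sep_line_identity P Q R0 t) as HI; cbv zeta in HI.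
fold S a b al be in HI.
replace (be * normdef P + al * b - (be * b - al * a) * t) with 0 in HI
  by (unfold t; field; lra).
assert (HRS : R0 <> S).
{ intros HS; apply HN; rewrite HS; unfold S, cross; simpl; ring. }
pose proof (sep_pos R0 S HR HRS). pose proof (sep_pos P Q HP HPQ).
exists S; split; [|split; [now exists t|lra]].
(* The left side of the identity is positive before S is known to lie in the disk, and this forces
   [normdef S] to be positive. *)
assert (0 < cross P Q R0 ^ 2) by (apply pow2_gt_0; exact HN).
assert (0 < sep R0 S * sep P Q) by now apply Rmult_lt_0_compat.
assert (0 < normdef S) by nra.
unfold normdef, inD in *; lra.
Qed.

Lemma sep_on_line_ge (P Q R0 S : pt) : on_line P Q S ->
  cross P Q R0 ^ 2 * normdef S <= sep R0 S * sep P Q.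
Proof.
intros [t ->]. pose proof (sep_line_identity P Q R0 t) as HI; cbv zeta in HI.
match type of HI with _ = ?x ^ 2 => pose proof (pow2_ge_0 x) end. lra.
Qed.

Lemma sinh_Deltaprime_sq (P Q : pt) : inD P -> inD Q -> P <> Q ->
  sinh (Deltaprime P Q) ^ 2 * sep P Q = normdef P * normdef Q.
Proof.
intros HP HQ HN.
destruct (Deltaprime_spec P Q (dprime_pos P Q HP HQ HN)) as [_ H].
pose proof (sinh_dprime_sq P Q HP HQ) as H2.
assert (0 < normdef P) by (unfold normdef, inD in *; lra).
assert (0 < normdef Q) by (unfold normdef, inD in *; lra).
assert (H3 : sep P Q = sinh (dprime P Q) ^ 2 * (normdef P * normdef Q))
  by (rewrite H2; field; lra).
rewrite H3.
replace (sinh (Deltaprime P Q) ^ 2 * (sinh (dprime P Q) ^ 2 * (normdef P * normdef Q)))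
  with ((sinh (Deltaprime P Q) * sinh (dprime P Q)) ^ 2 * (normdef P * normdef Q)) by ring.
rewrite H; ring.
Qed.

(** The altitude of the triangle: the foot bounds the minimum from above, and the line inequality at
    the minimizing point bounds it from below. *)
Lemma sinh_delta_sq (P Q R0 : pt) (m : R) :
  inD P -> inD Q -> inD R0 -> noncollinear P Q R0 -> is_delta P Q R0 m ->
  sinh m ^ 2 * (normdef R0 * sep P Q) = cross P Q R0 ^ 2.
Proof.
intros HP HQ HR HN [[S [HS [HL Hm]]] Hmin].
assert (HPQ : P <> Q) by (intros ->; apply HN; unfold cross; ring).
destruct (foot_in_disk P Q R0 HP HQ HR HN) as [S' [HS' [HL' HE]]].
assert (HpR : 0 < normdef R0) by (unfold normdef, inD in *; lra).
assert (HpS : 0 < normdef S) by (unfold normdef, inD in *; lra).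
assert (HpS' : 0 < normdef S') by (unfold normdef, inD in *; lra).
pose proof (sep_pos P Q HP HPQ) as Hsep.
pose proof (sinh_dprime_sq R0 S HR HS) as H1.
pose proof (sinh_dprime_sq R0 S' HR HS') as H2.
pose proof (sep_on_line_ge P Q R0 S HL) as H3.
assert (H4 : sinh m ^ 2 <= sinh (dprime R0 S') ^ 2).
{ apply sinh_sq_le; [rewrite <- Hm; apply dprime_ge0|now apply Hmin]. }
rewrite Hm in H1. rewrite H2 in H4.
apply Rle_antisym.
- apply Rle_trans with (sep R0 S' / (normdef R0 * normdef S') * (normdef R0 * sep P Q)).
  + apply Rmult_le_compat_r; [nra|exact H4].
  + right. replace (sep R0 S' / (normdef R0 * normdef S') * (normdef R0 * sep P Q))
      with (sep R0 S' * sep P Q / normdef S') by (field; lra).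
    rewrite HE; field; lra.
- rewrite H1.
  replace (sep R0 S / (normdef R0 * normdef S) * (normdef R0 * sep P Q))
      with (sep R0 S * sep P Q / normdef S) by (field; lra).
  apply Rmult_le_reg_r with (normdef S); [lra|].
  replace (sep R0 S * sep P Q / normdef S * normdef S) with (sep R0 S * sep P Q)
    by (field; lra). exact H3.
Qed.

(** Equating the two squared hyperbolic sines cancels [sep P Q] and leaves a condition symmetric in
    the three vertices. *)
Lemma delta_eq_cross (P Q R0 : pt) :
  inD P -> inD Q -> inD R0 -> noncollinear P Q R0 ->
  is_delta P Q R0 (Deltaprime P Q) ->
  cross P Q R0 ^ 2 = normdef P * normdef Q * normdef R0.
Proof.
intros HP HQ HR HN Hd.
assert (HPQ : P <> Q) by (intros ->; apply HN; unfold cross; ring).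
rewrite <- (sinh_delta_sq P Q R0 _ HP HQ HR HN Hd),
  <- (sinh_Deltaprime_sq P Q HP HQ HPQ).
ring.
Qed.

Lemma delta_gt_cross (P Q R0 : pt) (m : R) :
  inD P -> inD Q -> inD R0 -> noncollinear P Q R0 ->
  is_delta P Q R0 m -> m > Deltaprime P Q ->
  normdef P * normdef Q * normdef R0 < cross P Q R0 ^ 2.
Proof.
intros HP HQ HR HN Hd Hm.
assert (HPQ : P <> Q) by (intros ->; apply HN; unfold cross; ring).
pose proof (sinh_delta_sq P Q R0 _ HP HQ HR HN Hd) as H1.
pose proof (sinh_Deltaprime_sq P Q HP HQ HPQ) as H2.
destruct (Deltaprime_spec P Q (dprime_pos P Q HP HQ HPQ)) as [H3 _].
assert (H4 : sinh (Deltaprime P Q) ^ 2 < sinh m ^ 2) by (apply sinh_sq_lt; lra).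
pose proof (sep_pos P Q HP HPQ).
assert (0 < normdef R0) by (unfold normdef, inD in *; lra).
rewrite <- H1, <- H2.
replace (sinh (Deltaprime P Q) ^ 2 * sep P Q * normdef R0)
  with (sinh (Deltaprime P Q) ^ 2 * (normdef R0 * sep P Q)) by ring.
apply Rmult_lt_compat_r; [nra|exact H4].
Qed.

(** * Lifts of circle maps *)

Definition circle_lift (F : R -> R) : Prop :=
  continuity F /\ (forall s t, s < t -> F s < F t) /\
  (forall t, F (t + 1) = F t + 1) /\ (forall t, t < F t < t + 1).

(** Its zeros are the points of period 3 whose orbit winds exactly once around the circle. *)
Definition disp3 (F : R -> R) (t : R) : R := F (F (F t)) - t - 1.

Lemma continuity_disp3 (F : R -> R) : circle_lift F -> continuity (disp3 F).
Proof.
intros [HF _].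
assert (H2 : continuity (fun t => F (F t))) by exact (continuity_comp F F HF HF).
assert (H3 : continuity (fun t => F (F (F t)))) by exact (continuity_comp _ F H2 HF).
unfold disp3; apply continuity_minus.
- apply continuity_minus; [exact H3|apply derivable_continuous, derivable_id].
- apply continuity_const; now intros ? ?.
Qed.

Lemma ivt_between (f : R -> R) (a b y : R) : continuity f -> a <= b ->
  (f a <= y <= f b \/ f b <= y <= f a) -> exists x, a <= x <= b /\ f x = y.
Proof.
intros Hf Hab Hy.
destruct (IVT_gen f a b y Hf) as [x [Hx E]].
- unfold Rmin, Rmax; destruct (Rle_dec (f a) (f b)); lra.
- exists x; split; [|exact E].
  now rewrite Rmin_left, Rmax_right in Hx.
Qed.

Lemma pos_of_no_zero (f : R -> R) (a b s : R) : continuity f ->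
  (forall t, a < t < b -> f t <> 0) -> a < s < b -> 0 < f s ->
  forall t, a < t < b -> 0 < f t.
Proof.
intros Hf Hz Hs Hp t Ht.
destruct (Rlt_le_dec 0 (f t)) as [H|H]; [exact H|exfalso].
destruct (Rle_dec s t) as [L|L].
- destruct (ivt_between f s t 0 Hf L) as [x [Hx E]]; [lra|].
  apply (Hz x); [lra|exact E].
- destruct (ivt_between f t s 0 Hf) as [x [Hx E]]; [lra|lra|].
  apply (Hz x); [lra|exact E].
Qed.

Lemma neg_of_no_zero (f : R -> R) (a b s : R) : continuity f ->
  (forall t, a < t < b -> f t <> 0) -> a < s < b -> f s < 0 ->
  forall t, a < t < b -> f t < 0.
Proof.
intros Hf Hz Hs Hp t Ht.
assert (0 < - f t); [|lra].
apply (pos_of_no_zero (fun x => - f x) a b s); try lra.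
- now apply continuity_opp.
- intros x Hx; specialize (Hz x Hx); lra.
Qed.

(** The iterates increase and stay below b; their limit is a fixed point, and b is the only one in
    reach. *)
Lemma iter_increasing_to_fixpoint (K : R -> R) (a b t : R) : continuity K ->
  (forall x y, x <= y -> K x <= K y) -> K b = b ->
  (forall x, a < x < b -> x < K x) -> a < t <= b ->
  is_lim_seq (fun n => Nat.iter n K t) b.
Proof.
intros Kc Km Kb Kup Ht.
assert (Hin : forall n, t <= Nat.iter n K t <= b).
{ induction n as [|n IH]; simpl; [lra|].
  split.
  - destruct (Rle_lt_or_eq_dec _ _ (proj2 IH)) as [L|E]; [|rewrite E, Kb; lra].
    assert (Nat.iter n K t < K (Nat.iter n K t)) by (apply Kup; lra). lra.
  - rewrite <- Kb at 1. apply Km, IH. }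
assert (Hstep : forall n, Nat.iter n K t <= Nat.iter (S n) K t).
{ intros n; simpl. destruct (Hin n) as [H1 H2].
  destruct (Rle_lt_or_eq_dec _ _ H2) as [L|E]; [left; apply Kup; lra|rewrite E; lra]. }
destruct (ex_finite_lim_seq_incr _ b Hstep) as [l Hl]; [intros n; apply Hin|].
assert (Hl1 : t <= l).
{ apply (is_lim_seq_le (fun _ => t) (fun n => Nat.iter n K t) (Finite t) (Finite l));
    [intros n; apply Hin|apply is_lim_seq_const|exact Hl]. }
assert (Hl2 : l <= b).
{ apply (is_lim_seq_le (fun n => Nat.iter n K t) (fun _ => b) (Finite l) (Finite b));
    [intros n; apply Hin|exact Hl|apply is_lim_seq_const]. }
assert (HK : K l = l).
{ pose proof (is_lim_seq_continuous K _ l (Kc l) Hl) as H1.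
  apply is_lim_seq_incr_1 in Hl; simpl in Hl.
  apply is_lim_seq_unique in H1. apply is_lim_seq_unique in Hl.
  rewrite H1 in Hl. now injection Hl. }
destruct (Rle_lt_or_eq_dec _ _ Hl2) as [L| ->]; [|exact Hl].
specialize (Kup l); lra.
Qed.

Lemma iter_decreasing_to_fixpoint (K : R -> R) (a b t : R) : continuity K ->
  (forall x y, x <= y -> K x <= K y) -> K a = a ->
  (forall x, a < x < b -> K x < x) -> a <= t < b ->
  is_lim_seq (fun n => Nat.iter n K t) a.
Proof.
intros Kc Km Ka Kdn Ht.
(* Conjugation by the reflection x -> -x reduces to the increasing case. *)
set (K' := fun x => - K (- x)).
assert (Hit : forall n, Nat.iter n K' (- t) = - Nat.iter n K t).
{ induction n as [|n IH]; simpl; [reflexivity|].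
  unfold K' at 1. now rewrite IH, Ropp_involutive. }
assert (H : is_lim_seq (fun n => Nat.iter n K' (- t)) (- a)).
{ apply (iter_increasing_to_fixpoint K' (- b)).
  - apply continuity_opp, (continuity_comp (fun x => - x) K); [|exact Kc].
    apply continuity_opp, derivable_continuous, derivable_id.
  - intros x y Hxy; unfold K'; apply Ropp_le_contravar, Km; lra.
  - unfold K'; rewrite Ropp_involutive; lra.
  - intros x Hx; unfold K'; specialize (Kdn (- x)); lra.
  - lra. }
apply is_lim_seq_opp in H; simpl in H; rewrite Ropp_involutive in H.
apply is_lim_seq_ext with (2 := H); intros n; rewrite Hit; ring.
Qed.

(** * Arcs between neighbouring periodic points *)

Definition rising (F : R -> R) (a b : R) : Prop :=
  a < b /\ disp3 F a = 0 /\ disp3 F b = 0 /\ forall t, a < t < b -> 0 < disp3 F t.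

Definition falling (F : R -> R) (a b : R) : Prop :=
  a < b /\ disp3 F a = 0 /\ disp3 F b = 0 /\ forall t, a < t < b -> disp3 F t < 0.

(** F is increasing and commutes with [F^3 - 1], so it preserves the direction of motion. *)
Lemma disp3_sign_step (F : R -> R) (t : R) : circle_lift F ->
  (disp3 F t = 0 -> disp3 F (F t) = 0) /\ (0 < disp3 F t -> 0 < disp3 F (F t)) /\
  (disp3 F t < 0 -> disp3 F (F t) < 0).
Proof.
intros [_ [Hm [Hp _]]]; unfold disp3; repeat split; intros H.
- replace (F (F (F t))) with (t + 1) by lra. rewrite Hp; lra.
- assert (F (t + 1) < F (F (F (F t)))) by (apply Hm; lra). rewrite Hp in *; lra.
- assert (F (F (F (F t))) < F (t + 1)) by (apply Hm; lra). rewrite Hp in *; lra.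
Qed.

Lemma lift_preimage (F : R -> R) (a b t : R) : circle_lift F -> a < b ->
  F a < t < F b -> exists s, a < s < b /\ F s = t.
Proof.
intros [Hc [Hm _]] Hab Ht.
destruct (ivt_between F a b t Hc) as [s [Hs E]]; [lra|lra|].
exists s; split; [|exact E].
destruct (Req_dec s a) as [->|]; [lra|]. destruct (Req_dec s b) as [->|]; lra.
Qed.

Lemma rising_step (F : R -> R) (a b : R) : circle_lift F -> rising F a b ->
  rising F (F a) (F b).
Proof.
intros HF [Hab [Ha [Hb Hr]]].
split; [now apply HF|split; [now apply disp3_sign_step|split; [now apply disp3_sign_step|]]].
intros t Ht; destruct (lift_preimage F a b t HF Hab Ht) as [s [Hs <-]].
apply disp3_sign_step; auto.
Qed.

Lemma falling_step (F : R -> R) (a b : R) : circle_lift F -> falling F a b ->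
  falling F (F a) (F b).
Proof.
intros HF [Hab [Ha [Hb Hr]]].
split; [now apply HF|split; [now apply disp3_sign_step|split; [now apply disp3_sign_step|]]].
intros t Ht; destruct (lift_preimage F a b t HF Hab Ht) as [s [Hs <-]].
apply disp3_sign_step; auto.
Qed.

Lemma lift_shift_Z (F : R -> R) (k : Z) (t : R) : circle_lift F ->
  F (t + IZR k) = F t + IZR k.
Proof.
intros [_ [_ [Hp _]]].
assert (Hn : forall n t, F (t + INR n) = F t + INR n).
{ induction n as [|n IH]; intros s; [simpl; now rewrite !Rplus_0_r|].
  rewrite S_INR, <- !Rplus_assoc, Hp, IH; ring. }
destruct (Z_le_gt_dec 0 k) as [H|H].
- rewrite <- (Z2Nat.id k H), <- INR_IZR_INZ. apply Hn.
- replace k with (- Z.of_nat (Z.to_nat (- k)))%Z by lia.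
  rewrite opp_IZR, <- INR_IZR_INZ. set (n := Z.to_nat (- k)).
  pose proof (Hn n (t + - INR n)) as E.
  replace (t + - INR n + INR n) with t in E by ring. lra.
Qed.

Lemma disp3_periodic (F : R -> R) (k : Z) (t : R) : circle_lift F ->
  disp3 F (t + IZR k) = disp3 F t.
Proof. intros HF; unfold disp3; rewrite !(lift_shift_Z F) by exact HF; ring. Qed.

(** * A periodic orbit from the rotation number *)

Lemma periodic_min (f : R -> R) : continuity f ->
  (forall (k : Z) t, f (t + IZR k) = f t) -> exists s, forall t, f s <= f t.
Proof.
intros Hf Hp.
destruct (continuity_ab_min f 0 1) as [s [Hs _]]; [lra|intros; apply Hf|].
exists s; intros t.
rewrite <- (Hp (- Int_part t)%Z t), opp_IZR.
apply Hs. pose proof (base_Int_part t). lra.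
Qed.

Lemma iter3 (T : Type) (F : T -> T) (n : nat) (x : T) :
  Nat.iter (3 * n) F x = Nat.iter n (fun y => F (F (F y))) x.
Proof.
induction n as [|n IH]; [reflexivity|].
replace (3 * S n)%nat with (S (S (S (3 * n)))) by lia; simpl Nat.iter at 1.
simpl in IH |- *. now rewrite IH.
Qed.

Lemma iter3_ge (F : R -> R) (ep : R) (n : nat) : (forall t, ep <= disp3 F t) ->
  INR n * (1 + ep) <= Nat.iter (3 * n) F 0.
Proof.
intros H; rewrite iter3. induction n as [|n IH]; [simpl; lra|].
rewrite S_INR; simpl Nat.iter.
specialize (H (Nat.iter n (fun y => F (F (F y))) 0)); unfold disp3 in H; lra.
Qed.

Lemma iter3_le (F : R -> R) (ep : R) (n : nat) : (forall t, disp3 F t <= ep) ->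
  Nat.iter (3 * n) F 0 <= INR n * (1 + ep).
Proof.
intros H; rewrite iter3. induction n as [|n IH]; [simpl; lra|].
rewrite S_INR; simpl Nat.iter.
specialize (H (Nat.iter n (fun y => F (F (F y))) 0)); unfold disp3 in H; lra.
Qed.

(** The mean speed per step lies between (1 + min)/3 and (1 + max)/3 for the extrema of [disp3 F].
    As it equals 1/3, the extrema have opposite weak signs. *)
Lemma disp3_zero_of_rotation (F : R -> R) : circle_lift F ->
  is_lim_seq (fun n => Nat.iter n F 0 / INR n) (1 / 3) ->
  exists t, disp3 F t = 0.
Proof.
intros HF Hlim.
pose proof (continuity_disp3 F HF) as Hc.
(* The indices start at 3 so that the denominators do not vanish. *)
assert (Hsub : is_lim_seq (fun n => Nat.iter (3 * S n) F 0 / INR (3 * S n)) (1 / 3)).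
{ apply (is_lim_seq_subseq _ _ (fun n => (3 * S n)%nat)) in Hlim; [exact Hlim|].
  intros P [N HN]; exists N; intros n Hn; apply HN; lia. }
assert (Hpos : forall n, 0 < INR (S n)) by (intros n; apply lt_0_INR; lia).
assert (H3 : forall n, INR (3 * S n) = 3 * INR (S n)).
{ intros n; rewrite mult_INR; simpl (INR 3); ring. }
destruct (periodic_min (disp3 F) Hc) as [s Hs].
{ intros k t; now apply disp3_periodic. }
(* The maximum of [disp3 F], as the minimum of its opposite. *)
destruct (periodic_min (fun t => - disp3 F t)) as [s' Hs'].
{ now apply continuity_opp. }
{ intros k t; now rewrite disp3_periodic. }
assert (A : disp3 F s <= 0).
{ assert ((1 + disp3 F s) / 3 <= 1 / 3); [|lra].
  apply (is_lim_seq_le (fun _ => (1 + disp3 F s) / 3) _ (Finite _) (Finite _))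
    with (2 := is_lim_seq_const _) (3 := Hsub).
  intros n. apply Rmult_le_reg_r with (INR (3 * S n)); [rewrite H3; specialize (Hpos n); lra|].
  replace (Nat.iter (3 * S n) F 0 / INR (3 * S n) * INR (3 * S n))
    with (Nat.iter (3 * S n) F 0) by (field; rewrite H3; specialize (Hpos n); lra).
  rewrite H3. pose proof (iter3_ge F _ (S n) Hs). lra. }
assert (B : 0 <= disp3 F s').
{ assert (1 / 3 <= (1 + disp3 F s') / 3); [|lra].
  apply (is_lim_seq_le _ (fun _ => (1 + disp3 F s') / 3) (Finite _) (Finite _))
    with (2 := Hsub) (3 := is_lim_seq_const _).
  intros n. apply Rmult_le_reg_r with (INR (3 * S n)); [rewrite H3; specialize (Hpos n); lra|].
  replace (Nat.iter (3 * S n) F 0 / INR (3 * S n) * INR (3 * S n))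
    with (Nat.iter (3 * S n) F 0) by (field; rewrite H3; specialize (Hpos n); lra).
  assert (Hs2 : forall t, disp3 F t <= disp3 F s') by (intros t; specialize (Hs' t); lra).
  rewrite H3. pose proof (iter3_le F _ (S n) Hs2). lra. }
destruct (Rle_dec s s') as [L|L].
- destruct (ivt_between (disp3 F) s s' 0 Hc L) as [t [_ E]]; [lra|now exists t].
- destruct (ivt_between (disp3 F) s' s 0 Hc) as [t [_ E]]; [lra|lra|now exists t].
Qed.

(** * From the line to the circle *)

Lemma e_eq_iff (s t : R) : e s = e t <-> exists k : Z, s = t + IZR k.
Proof.
split.
- intros H; injection H as H1 H2.
  (* The cosine of the difference is 1; halving the angle turns this into a zero of the sine. *)
  assert (Hs : sin (PI * (s - t)) = 0).
  { assert (Hc : cos (2 * PI * s - 2 * PI * t) = 1).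
    { rewrite cos_minus, H1, H2.
      pose proof (sin2_cos2 (2 * PI * t)) as E; unfold Rsqr in E; lra. }
    replace (2 * PI * s - 2 * PI * t) with (2 * (PI * (s - t))) in Hc by ring.
    rewrite cos_2a_sin in Hc.
    destruct (Req_dec (sin (PI * (s - t))) 0) as [E|E]; [exact E|nra]. }
  destruct (sin_eq_0_0 _ Hs) as [k Hk]; exists k.
  pose proof PI_RGT_0.
  apply Rmult_eq_reg_l with PI; lra.
- intros [k ->]; unfold e.
  assert (Hn : forall n t, cos (2 * PI * (t + INR n)) = cos (2 * PI * t) /\
                           sin (2 * PI * (t + INR n)) = sin (2 * PI * t)).
  { intros n u. replace (2 * PI * (u + INR n)) with (2 * PI * u + 2 * INR n * PI) by ring.
    now rewrite cos_period, sin_period. }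
  destruct (Z_le_gt_dec 0 k) as [H|H].
  + rewrite <- (Z2Nat.id k H), <- INR_IZR_INZ. now destruct (Hn (Z.to_nat k) t) as [-> ->].
  + replace k with (- Z.of_nat (Z.to_nat (- k)))%Z by lia.
    rewrite opp_IZR, <- INR_IZR_INZ. set (n := Z.to_nat (- k)).
    destruct (Hn n (t + - INR n)) as [E1 E2].
    replace (t + - INR n + INR n) with t in E1, E2 by ring. now rewrite E1, E2.
Qed.

Lemma IZR_small (k : Z) : -1 < IZR k < 1 -> IZR k = 0.
Proof.
intros [H1 H2]. apply lt_IZR in H1. apply lt_IZR in H2.
now replace k with 0%Z by lia.
Qed.

(** The length [d] and b - a both lie in [0,1) and differ by an integer, so they agree. *)
Lemma in_arc_lift (a b : R) (v : pt) : a <= b < a + 1 -> in_arc (e a) (e b) v ->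
  exists t, a <= t <= b /\ v = e t.
Proof.
intros Hab [a0 [d [s [H1 [H2 [H3 [H4 H5]]]]]]].
apply e_eq_iff in H1 as [k Hk]. apply e_eq_iff in H2 as [l Hl].
assert (Hd : IZR (k - l) = 0).
{ apply IZR_small; rewrite minus_IZR; lra. }
rewrite minus_IZR in Hd.
exists (a + s); split; [lra|].
rewrite H3; apply e_eq_iff; exists (- k)%Z; rewrite opp_IZR; lra.
Qed.

Lemma lift_in_arc (a b t : R) : a <= t <= b -> b < a + 1 -> in_arc (e a) (e b) (e t).
Proof.
intros H1 H2; exists a, (b - a), (t - a); repeat split; try lra; f_equal; lra.
Qed.

Lemma e_continuous_seq (u : nat -> R) (l : R) : is_lim_seq u l ->
  is_lim_seq (fun n => fst (e (u n))) (fst (e l)) /\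
  is_lim_seq (fun n => snd (e (u n))) (snd (e l)).
Proof.
intros H; unfold e; simpl; split.
- apply (is_lim_seq_continuous (fun x => cos (2 * PI * x))); [|exact H].
  apply derivable_continuous_pt; reg.
- apply (is_lim_seq_continuous (fun x => sin (2 * PI * x))); [|exact H].
  apply derivable_continuous_pt; reg.
Qed.

Definition lifts (F : R -> R) (psi : pt -> pt) : Prop := forall t, e (F t) = psi (e t).

(** Subtracting 1 after every three steps undoes the winding, so that the lifted orbit can
    converge. *)
Lemma conv3_of_lift (F : R -> R) (psi : pt -> pt) (t l : R) : lifts F psi ->
  is_lim_seq (fun n => Nat.iter n (fun x => F (F (F x)) - 1) t) l ->
  conv3 psi (e t) (e l).
Proof.
intros HL H.
assert (E : forall n, Nat.iter (3 * n) psi (e t)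
              = e (Nat.iter n (fun x => F (F (F x)) - 1) t)).
{ intros n; rewrite iter3. induction n as [|n IH]; [reflexivity|]; simpl.
  rewrite IH, <- !HL. apply e_eq_iff; exists 1%Z; simpl; lra. }
destruct (e_continuous_seq _ _ H) as [H1 H2]; split.
- apply is_lim_seq_ext with (2 := H1); intros n; now rewrite E.
- apply is_lim_seq_ext with (2 := H2); intros n; now rewrite E.
Qed.

Lemma lift3_continuous_monotone (F : R -> R) : circle_lift F ->
  continuity (fun x => F (F (F x)) - 1) /\
  forall x y, x <= y -> F (F (F x)) - 1 <= F (F (F y)) - 1.
Proof.
intros [HF [Hm _]]; split.
- assert (H2 : continuity (fun t => F (F t))) by exact (continuity_comp F F HF HF).
  assert (H3 : continuity (fun t => F (F (F t)))) by exact (continuity_comp _ F H2 HF).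
  apply continuity_minus; [exact H3|apply continuity_const; now intros ? ?].
- intros x y [H| ->]; [|lra].
  assert (F (F (F x)) < F (F (F y))) by now apply Hm, Hm, Hm. lra.
Qed.

Lemma rising_conv3 (F : R -> R) (psi : pt -> pt) (a b t : R) :
  circle_lift F -> lifts F psi -> rising F a b -> a < t <= b ->
  conv3 psi (e t) (e b).
Proof.
intros HF HL [Hab [Ha [Hb Hr]]] Ht.
apply conv3_of_lift with F; [exact HL|].
destruct (lift3_continuous_monotone F HF) as [H1 H2].
apply (iter_increasing_to_fixpoint _ a b); try assumption.
- unfold disp3 in Hb; lra.
- intros x Hx; specialize (Hr x Hx); unfold disp3 in Hr; lra.
Qed.

Lemma falling_conv3 (F : R -> R) (psi : pt -> pt) (a b t : R) :
  circle_lift F -> lifts F psi -> falling F a b -> a <= t < b ->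
  conv3 psi (e t) (e a).
Proof.
intros HF HL [Hab [Ha [Hb Hr]]] Ht.
apply conv3_of_lift with F; [exact HL|].
destruct (lift3_continuous_monotone F HF) as [H1 H2].
apply (iter_decreasing_to_fixpoint _ a b); try assumption.
- unfold disp3 in Ha; lra.
- intros x Hx; specialize (Hr x Hx); unfold disp3 in Hr; lra.
Qed.

Lemma iter3_fixed (F : R -> R) (psi : pt -> pt) (t : R) :
  lifts F psi -> disp3 F t = 0 -> psi (psi (psi (e t))) = e t.
Proof.
intros HL H; rewrite <- !HL. apply e_eq_iff; exists 1%Z; unfold disp3 in H; lra.
Qed.

Lemma e_onS1 (t : R) : onS1 (e t).
Proof.
unfold onS1, e; simpl fst; simpl snd.
pose proof (sin2_cos2 (2 * PI * t)) as H; unfold Rsqr in H; simpl; lra.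
Qed.

(** The images of the rising arc under F and F^2 complete it to one full turn; on each arc the
    points move to the right end. *)
Lemma conv3_semistable (F : R -> R) (psi : pt -> pt) (t1 : R) :
  circle_lift F -> lifts F psi -> rising F t1 (F t1) ->
  exists u1, onS1 u1 /\ Nat.iter 3 psi u1 = u1 /\
    let u2 := psi u1 in let u3 := psi (psi u1) in
    (forall v, in_arc u3 u1 v -> v <> u3 -> conv3 psi v u1) /\
    (forall v, in_arc u1 u2 v -> v <> u1 -> conv3 psi v u2) /\
    (forall v, in_arc u2 u3 v -> v <> u2 -> conv3 psi v u3).
Proof.
intros HF HL H1.
pose proof (rising_step F _ _ HF H1) as H2.
pose proof (rising_step F _ _ HF H2) as H3.
assert (Harc : forall a b v, a < b < a + 1 -> rising F a b ->
          in_arc (e a) (e b) v -> v <> e a -> conv3 psi v (e b)).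
{ intros a b v Hab Hr Hv Hn.
  destruct (in_arc_lift a b v) as [t [Ht ->]]; [lra|exact Hv|].
  apply (rising_conv3 F psi a b); try assumption.
  destruct (Req_dec t a) as [->|]; [now destruct Hn|lra]. }
assert (H0 : psi (psi (psi (e t1))) = e t1) by (apply (iter3_fixed F); [exact HL|apply H1]).
exists (e t1); split; [apply e_onS1|split; [exact H0|]].
(* As the right end of the arc that starts at u3, the point u1 is lifted one turn later. *)
assert (E3 : e t1 = e (F (F (F t1)))) by now rewrite !HL.
cbv zeta; rewrite <- !HL; split; [|split]; intros v.
- rewrite E3; apply Harc; [apply HF|assumption].
- apply Harc; [apply HF|assumption].
- apply Harc; [apply HF|assumption].
Qed.

(** Repelling points [s0], [F s0], ... alternate with attracting points [t0], [F t0], ... *)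
Lemma conv3_attracting (F : R -> R) (psi : pt -> pt) (s0 t0 : R) :
  circle_lift F -> lifts F psi -> rising F s0 t0 -> falling F t0 (F s0) ->
  exists u1, onS1 u1 /\ Nat.iter 3 psi u1 = u1 /\
    let u2 := psi u1 in let u3 := psi (psi u1) in
    exists v1, in_arc u1 u2 v1 /\ v1 <> u1 /\ v1 <> u2 /\
      Nat.iter 3 psi v1 = v1 /\
      let v2 := psi v1 in let v3 := psi (psi v1) in
      (forall v, in_arc v3 v1 v -> v <> v3 -> v <> v1 -> conv3 psi v u1) /\
      (forall v, in_arc v1 v2 v -> v <> v1 -> v <> v2 -> conv3 psi v u2) /\
      (forall v, in_arc v2 v3 v -> v <> v2 -> v <> v3 -> conv3 psi v u3).
Proof.
intros HF HL H1 G1.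
pose proof (rising_step F _ _ HF H1) as H2.
pose proof (rising_step F _ _ HF H2) as H3.
pose proof (falling_step F _ _ HF G1) as G2.
pose proof (falling_step F _ _ HF G2) as G3.
assert (Harc : forall a c b v, a < b < a + 1 -> rising F a c -> falling F c b ->
          in_arc (e a) (e b) v -> v <> e a -> v <> e b -> conv3 psi v (e c)).
{ intros a c b v Hab Hr Hf Hv Hna Hnb.
  destruct (in_arc_lift a b v) as [t [Ht ->]]; [lra|exact Hv|].
  assert (t <> a) by (intros ->; now destruct Hna).
  assert (t <> b) by (intros ->; now destruct Hnb).
  destruct (Rle_dec t c) as [L|L].
  - apply (rising_conv3 F psi a c); try assumption; lra.
  - apply (falling_conv3 F psi c b); try assumption; lra. }
assert (Es : psi (psi (psi (e s0))) = e s0) by (apply (iter3_fixed F); [exact HL|apply H1]).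
assert (Et : psi (psi (psi (e t0))) = e t0) by (apply (iter3_fixed F); [exact HL|apply H1]).
destruct HF as [Fc [Fm [Fp Fw]]].
pose proof (proj1 H1). pose proof (proj1 G1). pose proof (proj1 H2). pose proof (Fw t0).
assert (Hne : forall x y, x < y < x + 1 -> e x <> e y).
{ intros x y Hxy E; apply e_eq_iff in E as [k Hk].
  pose proof (IZR_small k); lra. }
exists (e t0); split; [apply e_onS1|split; [exact Et|]].
(* [F s0], rather than [s0], lies between [t0] and [F t0]; then v3 is [e s0]. *)
cbv zeta. exists (e (F s0)). rewrite <- !HL. split; [apply lift_in_arc; lra|].
split; [apply not_eq_sym, Hne; lra|split; [apply Hne; lra|]].
assert (E3 : e (F (F (F s0))) = e s0) by now rewrite !HL.
split; [simpl; now rewrite !HL, Es|].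
split; [|split]; intros v.
- rewrite E3; apply Harc; [apply Fw|assumption..].
- apply Harc; [apply Fw|assumption..].
- apply Harc; [apply Fw|assumption..].
Qed.

(** * Chords and half-turns *)

Definition half (t : R) : pt := (cos (PI * t), sin (PI * t)).

Definition det (p q : pt) : R := fst p * snd q - snd p * fst q.

(** The symmetric matrix with rows (1-x, -y) and (-y, 1+x), of determinant [normdef X]. *)
Definition bil (X p q : pt) : R :=
  (1 - fst X) * fst p * fst q - snd X * (fst p * snd q + snd p * fst q)
  + (1 + fst X) * snd p * snd q.

(* A quarter turn after the matrix of [bil X]; its square is scalar. *)
Definition turn (X p : pt) : pt :=
  (snd X * fst p - (1 + fst X) * snd p, (1 - fst X) * fst p - snd X * snd p).

Definition hgap (X : pt) (a b : R) : R := bil X (half a) (half b).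

Lemma half_unit (t : R) : cos (PI * t) * cos (PI * t) + sin (PI * t) * sin (PI * t) = 1.
Proof. pose proof (sin2_cos2 (PI * t)) as H; unfold Rsqr in H; lra. Qed.

Lemma det_half (a b : R) : det (half a) (half b) = sin (PI * (b - a)).
Proof.
unfold det, half; simpl.
replace (PI * (b - a)) with (PI * b - PI * a) by ring. rewrite sin_minus; ring.
Qed.

(** For a < b < a+1 the sine is positive, so [hgap] tells on which side of the chord X lies; unlike
    [cross] it does not degenerate at a = b. *)
Lemma cross_e (a b : R) (X : pt) :
  cross (e a) (e b) X = 2 * sin (PI * (b - a)) * hgap X a b.
Proof.
rewrite <- det_half.
unfold cross, e, hgap, bil, det, half; simpl fst; simpl snd.
replace (2 * PI * a) with (2 * (PI * a)) by ring.
replace (2 * PI * b) with (2 * (PI * b)) by ring.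
rewrite !cos_2a, !sin_2a.
pose proof (half_unit a) as Ha; pose proof (half_unit b) as Hb.
set (c := cos (PI * a)) in *; set (s := sin (PI * a)) in *.
set (c' := cos (PI * b)) in *; set (s' := sin (PI * b)) in *.
apply Rminus_diag_uniq.
(* The difference is an explicit combination of the two relations cos^2 + sin^2 = 1. *)
transitivity (
  (c * c + s * s - 1) * (2 * s' * c' * fst X + (s' * s' - c' * c') * snd X)
  + (c' * c' + s' * s' - 1) * (- 2 * s * c * fst X + (c * c - s * s) * snd X)).
2: rewrite Ha, Hb; ring.
ring.
Qed.

Lemma bil_sym (X p q : pt) : bil X p q = bil X q p.
Proof. unfold bil; ring. Qed.

Lemma det_turn (X p q : pt) : det p (turn X q) = bil X p q.
Proof. unfold det, turn, bil; simpl; ring. Qed.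

(** A full turn of the circle point reverses its half-angle direction. *)
Lemma hgap_shift_l (X : pt) (a b : R) : hgap X (a + 1) b = - hgap X a b.
Proof.
unfold hgap, bil, half; simpl.
replace (PI * (a + 1)) with (PI * a + PI) by ring. rewrite neg_cos, neg_sin; ring.
Qed.

Lemma hgap_shift_r (X : pt) (a b : R) : hgap X a (b + 1) = - hgap X a b.
Proof. unfold hgap; rewrite !(bil_sym X (half a)); apply hgap_shift_l. Qed.

(** The value is 1 - X.e(a), positive because |X| < 1. *)
Lemma hgap_diag_pos (X : pt) (a : R) : inD X -> 0 < hgap X a a.
Proof.
unfold inD, hgap, bil, half; simpl fst; simpl snd; intros HX.
pose proof (half_unit a) as Ha.
set (c := cos (PI * a)) in *; set (s := sin (PI * a)) in *.
assert (E : (c * c - s * s)^2 + (2 * s * c)^2 = 1).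
{ replace 1 with ((c * c + s * s)^2) by (rewrite Ha; ring). ring. }
pose proof (pow2_ge_0 (fst X - (c * c - s * s))).
pose proof (pow2_ge_0 (snd X - 2 * s * c)). nra.
Qed.

Lemma sin_PI_pos (x : R) : 0 < x < 1 -> 0 < sin (PI * x).
Proof. intros Hx; pose proof PI_RGT_0; apply sin_gt_0; nra. Qed.

Lemma sin_PI_ge0 (x : R) : 0 <= x <= 1 -> 0 <= sin (PI * x).
Proof. intros Hx; pose proof PI_RGT_0; apply sin_ge_0; nra. Qed.

(* The involution of the circle through an interior point preserves the cyclic order. *)
Lemma hgap_interlace (X : pt) (a a' b' b : R) : inD X ->
  a <= a' -> a' < b' -> b' <= b -> b < a + 1 -> (a < a' \/ b' < b) ->
  hgap X a' b' = 0 -> hgap X a b < 0.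
Proof.
intros HX H1 H2 H3 H4 H5 H0.
(* Cramer's rule expands [half a] and [half b] in the basis [half a'], [half b']; the coefficients
   are sines. *)
assert (E : hgap X a b * (sin (PI * (b' - a')))^2 =
  - (sin (PI * (b' - a)) * sin (PI * (b - b')) * hgap X a' a'
     + sin (PI * (a' - a)) * sin (PI * (b - a')) * hgap X b' b')
  + (sin (PI * (b' - a)) * sin (PI * (b - a')) + sin (PI * (a' - a)) * sin (PI * (b - b')))
    * hgap X a' b').
{ rewrite <- !det_half. unfold hgap, det, bil; ring. }
rewrite H0 in E.
pose proof (hgap_diag_pos X a' HX) as P1. pose proof (hgap_diag_pos X b' HX) as P2.
assert (S0 : 0 < sin (PI * (b' - a'))) by (apply sin_PI_pos; lra).
assert (S1 : 0 < sin (PI * (b' - a))) by (apply sin_PI_pos; lra).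
assert (S2 : 0 < sin (PI * (b - a'))) by (apply sin_PI_pos; lra).
assert (S3 : 0 <= sin (PI * (b - b'))) by (apply sin_PI_ge0; lra).
assert (S4 : 0 <= sin (PI * (a' - a))) by (apply sin_PI_ge0; lra).
assert (Q0 : 0 < (sin (PI * (b' - a')))^2) by now apply pow_lt.
assert (Q1 : 0 <= sin (PI * (b' - a)) * sin (PI * (b - b')) * hgap X a' a')
  by (repeat apply Rmult_le_pos; lra).
assert (Q2 : 0 <= sin (PI * (a' - a)) * sin (PI * (b - a')) * hgap X b' b')
  by (repeat apply Rmult_le_pos; lra).
assert (0 < sin (PI * (b' - a)) * sin (PI * (b - b')) * hgap X a' a'
     + sin (PI * (a' - a)) * sin (PI * (b - a')) * hgap X b' b').
{ destruct H5 as [H5|H5].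
  - assert (0 < sin (PI * (a' - a)) * sin (PI * (b - a')) * hgap X b' b'); [|lra].
    repeat apply Rmult_lt_0_compat; try lra. apply sin_PI_pos; lra.
  - assert (0 < sin (PI * (b' - a)) * sin (PI * (b - b')) * hgap X a' a'); [|lra].
    repeat apply Rmult_lt_0_compat; try lra. apply sin_PI_pos; lra. }
nra.
Qed.

(** * Supporting chords and the lift of psi *)

Definition contact (P Q R0 : pt) (a b : R) : Prop :=
  (0 <= hgap P a b /\ 0 <= hgap Q a b /\ 0 <= hgap R0 a b) /\
  (hgap P a b = 0 \/ hgap Q a b = 0 \/ hgap R0 a b = 0).

Lemma continuity_hgap (X : pt) (f g : R -> R) : continuity f -> continuity g ->
  continuity (fun t => hgap X (f t) (g t)).
Proof.
intros Hf Hg.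
assert (Hk : forall k : R, continuity (fun _ => k)).
{ intros k; apply continuity_const; now intros ? ?. }
assert (Hc : forall h, continuity h -> continuity (fun t => cos (PI * h t))).
{ intros h Hh; apply (continuity_comp (fun t => PI * h t) cos).
  - apply (continuity_mult (fun _ => PI) h); auto.
  - apply continuity_cos. }
assert (Hs : forall h, continuity h -> continuity (fun t => sin (PI * h t))).
{ intros h Hh; apply (continuity_comp (fun t => PI * h t) sin).
  - apply (continuity_mult (fun _ => PI) h); auto.
  - apply continuity_sin. }
assert (Hm : forall u v, continuity u -> continuity v -> continuity (fun t => u t * v t))
  by (intros u v; apply continuity_mult).
assert (Hp : forall u v, continuity u -> continuity v -> continuity (fun t => u t + v t))
  by (intros u v; apply continuity_plus).
assert (Hb : forall u v, continuity u -> continuity v -> continuity (fun t => u t - v t))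
  by (intros u v; apply continuity_minus).
unfold hgap, bil, half; simpl.
apply Hp; [apply Hb|]; repeat (apply Hm || apply Hp); auto.
Qed.

Lemma continuity_Rmin (f g : R -> R) : continuity f -> continuity g ->
  continuity (fun t => Rmin (f t) (g t)).
Proof.
intros Hf Hg x.
apply continuity_pt_ext with (f := fun t => (f t + g t - Rabs (f t - g t)) * / 2).
{ intros t; unfold Rmin, Rabs; destruct Rle_dec, Rcase_abs; lra. }
revert x; apply (continuity_mult (fun t => f t + g t - Rabs (f t - g t)) (fun _ => / 2)).
- apply (continuity_minus (fun t => f t + g t) (fun t => Rabs (f t - g t))).
  + now apply continuity_plus.
  + apply (continuity_comp (fun t => f t - g t) Rabs); [now apply continuity_minus|].
    apply Rcontinuity_abs.
- apply continuity_const; now intros ? ?.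
Qed.

(** The minimum of the three gaps is positive at a and negative at b; a zero in between is a
    contact. *)
Lemma contact_before (P Q R0 : pt) (a b : R) : inD P -> inD Q -> inD R0 -> a < b ->
  (hgap P a b < 0 \/ hgap Q a b < 0 \/ hgap R0 a b < 0) ->
  exists b', a < b' < b /\ contact P Q R0 a b'.
Proof.
intros HP HQ HR Hab Hneg.
set (f := fun s => Rmin (hgap P a s) (Rmin (hgap Q a s) (hgap R0 a s))).
assert (Hc : continuity f).
{ assert (H : forall X, continuity (fun s => hgap X a s)).
  { intros X; apply (continuity_hgap X (fun _ => a) (fun s => s)).
    - apply continuity_const; now intros ? ?.
    - apply derivable_continuous, derivable_id. }
  apply continuity_Rmin; [apply H|apply continuity_Rmin; apply H]. }
assert (Hfa : 0 < f a) by (repeat apply Rmin_glb_lt; now apply hgap_diag_pos).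
assert (Hfb : f b < 0).
{ unfold f, Rmin; repeat destruct Rle_dec; lra. }
destruct (ivt_between f a b 0 Hc) as [b' [Hb' E]]; [lra|lra|].
exists b'; split.
- split; destruct (Req_dec b' a); destruct (Req_dec b' b); subst; lra.
- revert E; unfold f, contact, Rmin; repeat destruct Rle_dec; lra.
Qed.

(** The first supporting chord keeps the triangle on its left: a vertex strictly on its right would
    produce an earlier supporting chord. *)
Lemma contact_of_psi (P Q R0 : pt) (a b : R) :
  inD P -> inD Q -> inD R0 -> a < b < a + 1 ->
  is_psi P Q R0 (e a) (e b) -> contact P Q R0 a b.
Proof.
intros HP HQ HR Hab [_ [_ [Hs Hfirst]]].
assert (S : 0 < sin (PI * (b - a))) by (apply sin_PI_pos; lra).
assert (Sg : forall X, (0 <= cross (e a) (e b) X -> 0 <= hgap X a b) /\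
                       (cross (e a) (e b) X <= 0 -> hgap X a b <= 0) /\
                       (cross (e a) (e b) X = 0 -> hgap X a b = 0)).
{ intros X; rewrite cross_e; repeat split; intros; nra. }
destruct (Sg P) as [P1 [P2 P3]]. destruct (Sg Q) as [Q1 [Q2 Q3]].
destruct (Sg R0) as [R1 [R2 R3]].
destruct Hs as [Hs Hz].
assert (Hz' : hgap P a b = 0 \/ hgap Q a b = 0 \/ hgap R0 a b = 0)
  by (destruct Hz as [H|[H|H]]; auto).
split; [|exact Hz'].
destruct Hs as [[H1 [H2 H3]]|[H1 [H2 H3]]]; [auto|].
specialize (P2 H1). specialize (Q2 H2). specialize (R2 H3).
destruct (Rlt_le_dec (hgap P a b) 0) as [L1|L1];
[|destruct (Rlt_le_dec (hgap Q a b) 0) as [L2|L2];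
[|destruct (Rlt_le_dec (hgap R0 a b) 0) as [L3|L3]; [|now repeat split]]];
exfalso; (destruct (contact_before P Q R0 a b) as [b' [Hb' [[C1 [C2 C3]] C4]]]; [tauto..|lra|tauto|]).
all: assert (S' : 0 < sin (PI * (b' - a))) by (apply sin_PI_pos; lra).
(* Minimality would put [e b] on the arc from a to b', although b' < b < a+1. *)
all: destruct (in_arc_lift a b' (e b)) as [t [Ht E]]; [lra| |
  apply e_eq_iff in E as [k Hk]; assert (IZR k = 0) by (apply IZR_small; lra); lra].
all: apply Hfirst; [apply e_onS1| |].
all: try (intros E; apply e_eq_iff in E as [k Hk];
  assert (IZR k = 0) by (apply IZR_small; lra); lra).
all: unfold supports; rewrite !cross_e; split; [left; repeat split; nra|].
all: destruct C4 as [E|[E|E]]; rewrite E, ?Rmult_0_r; tauto.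
Qed.

Definition contact_lift (P Q R0 : pt) (F : R -> R) : Prop :=
  (inD P /\ inD Q /\ inD R0) /\ circle_lift F /\ forall t, contact P Q R0 t (F t).

(** Since psi has no fixed point, F t - t avoids the integers and stays in (0,1) with its value at
    0. Monotonicity comes from interlacing of chords. *)
Lemma contact_lift_of_psi (P Q R0 : pt) (psi : pt -> pt) (F : R -> R) :
  inD P -> inD Q -> inD R0 -> (forall v, onS1 v -> is_psi P Q R0 v (psi v)) ->
  continuity F -> lifts F psi -> 0 < F 0 < 1 -> contact_lift P Q R0 F.
Proof.
intros HP HQ HR Hpsi Hc HL H0.
assert (Hpsi' : forall t, is_psi P Q R0 (e t) (e (F t))).
{ intros t; rewrite HL; apply Hpsi, e_onS1. }
assert (Hnz : forall t (k : Z), F t - t <> IZR k).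
{ intros t k E. destruct (Hpsi' t) as [_ [Hn _]]; apply Hn, e_eq_iff.
  exists k; lra. }
assert (Hcd : continuity (fun t => F t - t)).
{ apply (continuity_minus F (fun t => t)); [exact Hc|].
  apply derivable_continuous, derivable_id. }
assert (Hw : forall t, t < F t < t + 1).
{ intros t.
  assert (H : forall k : Z, ~ (F t - t <= IZR k <= F 0 - 0 \/ F 0 - 0 <= IZR k <= F t - t)).
  { intros k Hk. destruct (Rle_dec 0 t) as [L|L].
    - destruct (ivt_between _ 0 t (IZR k) Hcd L) as [x [_ E]]; [lra|now apply (Hnz x k)].
    - destruct (ivt_between _ t 0 (IZR k) Hcd) as [x [_ E]]; [lra|lra|now apply (Hnz x k)]. }
  pose proof (H 0%Z). pose proof (H 1%Z). lra. }
assert (Hct : forall t, contact P Q R0 t (F t)) by (intros t; now apply contact_of_psi).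
split; [now split|split; [|exact Hct]].
split; [exact Hc|split; [|split; [|exact Hw]]].
- intros s t Hst. pose proof (Hw s). pose proof (Hw t).
  destruct (Rle_dec (s + 1) t) as [L|L]; [lra|].
  destruct (Rlt_le_dec (F s) (F t)) as [G|G]; [exact G|exfalso].
  (* If the chord at t were nested under the one at s, the vertex touched at t would lie strictly
     right of the chord at s. *)
  assert (K : forall X, inD X -> hgap X t (F t) = 0 -> hgap X s (F s) < 0).
  { intros X HX; apply hgap_interlace; try assumption; lra. }
  destruct (Hct s) as [[K1 [K2 K3]] _].
  destruct (Hct t) as [_ [E|[E|E]]]; apply K in E; try assumption; lra.
- intros t. assert (E : e (F (t + 1)) = e (F t)).
  { rewrite !HL; f_equal; apply e_eq_iff; exists 1%Z; reflexivity. }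
  apply e_eq_iff in E as [k Hk]. pose proof (Hw t). pose proof (Hw (t + 1)).
  assert (E : IZR (k - 1) = 0) by (apply IZR_small; rewrite minus_IZR; lra).
  rewrite minus_IZR in E; lra.
Qed.

(** Serves the two orders in which the sides can meet the vertices, as the orientation of PQR is not
    fixed. *)
Lemma contact_lift_swap (P Q R0 : pt) (F : R -> R) :
  contact_lift P Q R0 F -> contact_lift R0 Q P F.
Proof.
intros [HD [HF Hc]]; split; [tauto|split; [exact HF|]].
intros t; destruct (Hc t); split; tauto.
Qed.

(** * The quadratic form of the composed half-turns *)

Definition qform (X Y Z p : pt) : R := det p (turn Z (turn Y (turn X p))).

(* The half-turns [turn] are traceless, so reversing the order of composition gives
   the adjugate up to sign, which has the same fixed directions. *)
Lemma qform_rev (X Y Z p : pt) : qform Z Y X p = qform X Y Z p.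
Proof. unfold qform, det, turn; simpl; ring. Qed.

(* The coefficient of [sin * cos] is, up to the choice of a rotated basis, the
   off-diagonal coefficient of the form; its square is the discriminant
   [tr^2 - 4 det] of the composed half-turns. *)
Lemma qform_expand (X Y Z : pt) (t1 : R) : qform X Y Z (half t1) = 0 ->
  exists be ga, be^2 = 4 * (cross X Y Z ^ 2 - normdef X * normdef Y * normdef Z) /\
    forall t, qform X Y Z (half t) =
      sin (PI * (t - t1)) * (be * cos (PI * (t - t1)) + ga * sin (PI * (t - t1))).
Proof.
intros H0.
assert (Hq : exists A B C, B^2 - 4 * A * C =
    4 * (cross X Y Z ^ 2 - normdef X * normdef Y * normdef Z) /\
    forall p, qform X Y Z p = A * fst p ^ 2 + B * fst p * snd p + C * snd p ^ 2).
{ exists (qform X Y Z (1, 0)),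
    (qform X Y Z (1, 1) - qform X Y Z (1, 0) - qform X Y Z (0, 1)),
    (qform X Y Z (0, 1)).
  split; [unfold qform, cross, normdef, det, turn; simpl; ring|].
  intros p; unfold qform, det, turn; simpl; ring. }
destruct Hq as [A [B [C [HD Hq]]]].
pose proof (half_unit t1) as H1.
rewrite Hq in H0. unfold half in H0; simpl fst in H0; simpl snd in H0.
set (c := cos (PI * t1)) in *. set (s := sin (PI * t1)) in *.
(* Coefficients in the basis of [half t1] and its quarter turn. The remaining one is the value at
   [half t1], namely 0, so [be^2] is the whole discriminant. *)
set (be := - 2 * A * c * s + B * (c * c - s * s) + 2 * C * s * c).
set (ga := A * s^2 - B * s * c + C * c^2).
exists be, ga; split.
- rewrite <- HD.
  replace (B^2 - 4 * A * C) with ((B^2 - 4 * A * C) * (c * c + s * s)^2)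
    by (rewrite H1; ring).
  replace (be^2) with (be^2 - 4 * (A * c^2 + B * c * s + C * s^2) * ga)
    by (rewrite H0; ring).
  unfold be, ga; ring.
- intros t; rewrite Hq; unfold half; simpl fst; simpl snd.
  replace (PI * t) with (PI * t1 + PI * (t - t1)) by ring.
  rewrite cos_plus, sin_plus; fold c s.
  set (k := cos (PI * (t - t1))). set (l := sin (PI * (t - t1))).
  transitivity (k^2 * (A * c^2 + B * c * s + C * s^2) + l * (be * k + ga * l)).
  + unfold be, ga; ring.
  + rewrite H0; ring.
Qed.

(** In the plane the orthogonal of [half b] for a definite form is a single direction. *)
Lemma hgap_orthogonal (X : pt) (a b c : R) : inD X -> hgap X b a = 0 -> hgap X b c = 0 ->
  sin (PI * (c - a)) = 0.
Proof.
intros HX H1 H2. rewrite <- det_half.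
assert (E : det (half a) (half c) * hgap X b b =
  det (half b) (half c) * hgap X b a + det (half a) (half b) * hgap X b c)
  by (unfold hgap, det, bil; ring).
rewrite H1, H2 in E. pose proof (hgap_diag_pos X b HX). nra.
Qed.

(** * Periodic triangles inscribed in the circle *)

Definition touches (X Y Z : pt) (F : R -> R) (t : R) : Prop :=
  disp3 F t = 0 /\ hgap X t (F t) = 0 /\ hgap Y (F t) (F (F t)) = 0 /\
  hgap Z (F (F t)) (F (F (F t))) = 0.

Lemma hgap_orbit_period (W : pt) (F : R -> R) (t : R) : circle_lift F -> disp3 F t = 0 ->
  hgap W (F (F (F t))) (F (F (F (F t)))) = hgap W t (F t).
Proof.
intros [_ [_ [Hp _]]] H0.
replace (F (F (F t))) with (t + 1) by (unfold disp3 in H0; lra).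
rewrite Hp, hgap_shift_l, hgap_shift_r; ring.
Qed.

(** Two consecutive sides through W would be the same chord, but F (F t) lies strictly between t and
    t+1. *)
Lemma hgap_next_nonzero (X Y Z W : pt) (F : R -> R) (t : R) :
  contact_lift X Y Z F -> disp3 F t = 0 -> inD W ->
  hgap W t (F t) = 0 -> hgap W (F t) (F (F t)) <> 0.
Proof.
intros [_ [[_ [Hm [_ Hw]]] _]] Ht HW H1 H2.
assert (S : sin (PI * (F (F t) - t)) = 0).
{ apply (hgap_orthogonal W t (F t)); [exact HW| |exact H2].
  unfold hgap in *; now rewrite bil_sym. }
pose proof (Hw t). pose proof (Hw (F t)). pose proof (Hw (F (F t))).
unfold disp3 in Ht.
assert (0 < sin (PI * (F (F t) - t))) by (apply sin_PI_pos; lra). lra.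
Qed.

(* Each side of the periodic triangle touches a vertex, and no vertex lies on two sides. *)
Lemma exists_touches (P Q R0 : pt) (F : R -> R) (t : R) :
  contact_lift P Q R0 F -> disp3 F t = 0 ->
  exists t', (t' = t \/ t' = F t \/ t' = F (F t)) /\
    (touches P Q R0 F t' \/ touches R0 Q P F t').
Proof.
intros HC H0.
pose proof HC as [[HP [HQ HR]] [HF Hc]].
assert (H1 : disp3 F (F t) = 0) by now apply disp3_sign_step.
assert (H2 : disp3 F (F (F t)) = 0) by now apply disp3_sign_step.
assert (HS : forall W, hgap W (F (F (F t))) (F (F (F (F t)))) = hgap W t (F t))
  by (intros W; now apply hgap_orbit_period).
assert (HS' : forall W, hgap W (F (F (F (F t)))) (F (F (F (F (F t))))) = hgap W (F t) (F (F t)))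
  by (intros W; now apply hgap_orbit_period).
assert (N0 : forall W, inD W -> hgap W t (F t) = 0 -> hgap W (F t) (F (F t)) <> 0)
  by (intros W; now apply (hgap_next_nonzero P Q R0)).
assert (N1 : forall W, inD W -> hgap W (F t) (F (F t)) = 0 ->
             hgap W (F (F t)) (F (F (F t))) <> 0)
  by (intros W; now apply (hgap_next_nonzero P Q R0)).
assert (N2 : forall W, inD W -> hgap W (F (F t)) (F (F (F t))) = 0 -> hgap W t (F t) <> 0).
{ intros W HW; rewrite <- HS; now apply (hgap_next_nonzero P Q R0). }
destruct (Hc t) as [_ C0]. destruct (Hc (F t)) as [_ C1]. destruct (Hc (F (F t))) as [_ C2].
unfold touches.
(* Of 27 assignments only the six bijections survive: three starting points times two
   orientations. *)
destruct C0 as [E0|[E0|E0]], C1 as [E1|[E1|E1]], C2 as [E2|[E2|E2]];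
  try (exfalso; eapply N0; [|exact E0|exact E1]; assumption);
  try (exfalso; eapply N1; [|exact E1|exact E2]; assumption);
  try (exfalso; eapply N2; [|exact E2|exact E0]; assumption);
  first [ exists t; split; [tauto|]; solve [left; auto|right; auto]
        | exists (F t); split; [tauto|]; rewrite !HS; solve [left; auto|right; auto]
        | exists (F (F t)); split; [tauto|]; rewrite !HS, !HS'; solve [left; auto|right; auto] ].
Qed.

Lemma touches_strict (X Y Z : pt) (F : R -> R) (t : R) :
  contact_lift X Y Z F -> touches X Y Z F t ->
  (0 < hgap Y t (F t) /\ 0 < hgap Z t (F t)) /\
  (0 < hgap X (F t) (F (F t)) /\ 0 < hgap Z (F t) (F (F t))) /\
  (0 < hgap X (F (F t)) (F (F (F t))) /\ 0 < hgap Y (F (F t)) (F (F (F t)))).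
Proof.
intros HC [H0 [E0 [E1 E2]]].
pose proof HC as [[HX [HY HZ]] [HF Hc]].
assert (H1 : disp3 F (F t) = 0) by now apply disp3_sign_step.
assert (H2 : disp3 F (F (F t)) = 0) by now apply disp3_sign_step.
assert (HS : forall W, hgap W (F (F (F t))) (F (F (F (F t)))) = hgap W t (F t))
  by (intros W; now apply hgap_orbit_period).
assert (N0 : forall W, inD W -> hgap W t (F t) = 0 -> hgap W (F t) (F (F t)) <> 0)
  by (intros W; now apply (hgap_next_nonzero X Y Z)).
assert (N1 : forall W, inD W -> hgap W (F t) (F (F t)) = 0 ->
             hgap W (F (F t)) (F (F (F t))) <> 0)
  by (intros W; now apply (hgap_next_nonzero X Y Z)).
assert (N2 : forall W, inD W -> hgap W (F (F t)) (F (F (F t))) = 0 -> hgap W t (F t) <> 0).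
{ intros W HW; rewrite <- HS; now apply (hgap_next_nonzero X Y Z). }
pose proof (N0 X HX E0). pose proof (N1 Y HY E1). pose proof (N2 Z HZ E2).
assert (hgap Y t (F t) <> 0) by (intros E; now apply (N0 Y HY E)).
assert (hgap Z (F t) (F (F t)) <> 0) by (intros E; now apply (N1 Z HZ E)).
assert (hgap X (F (F t)) (F (F (F t))) <> 0) by (intros E; now apply (N2 X HX E)).
destruct (Hc t) as [C0 _]. destruct (Hc (F t)) as [C1 _]. destruct (Hc (F (F t))) as [C2 _].
lra.
Qed.

(** By [det_turn] the image is parallel to [half b]; its determinant with [half a] gives the
    positive factor. *)
Lemma turn_half (X : pt) (a b : R) : inD X -> a < b < a + 1 -> hgap X a b = 0 ->
  exists mu, 0 < mu /\ turn X (half a) = (mu * fst (half b), mu * snd (half b)).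
Proof.
intros HX Hab H0.
assert (S : 0 < sin (PI * (b - a))) by (apply sin_PI_pos; lra).
exists (hgap X a a / sin (PI * (b - a))); split.
{ apply Rdiv_lt_0_compat; [now apply hgap_diag_pos|exact S]. }
rewrite <- det_half in *.
assert (E : forall x y, x * det (half a) (half b) = y * hgap X a a ->
             x = hgap X a a / det (half a) (half b) * y).
{ intros x y E. apply Rmult_eq_reg_r with (det (half a) (half b)); [|lra].
  rewrite E; field; lra. }
rewrite (surjective_pairing (turn X (half a))).
f_equal; apply E.
- transitivity (fst (half b) * hgap X a a - fst (half a) * hgap X a b);
    [unfold turn, det, hgap, bil; simpl; ring|rewrite H0; ring].
- transitivity (snd (half b) * hgap X a a - snd (half a) * hgap X a b);
    [unfold turn, det, hgap, bil; simpl; ring|rewrite H0; ring].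
Qed.

Lemma turn_scal (X p : pt) (k : R) :
  turn X (k * fst p, k * snd p) = (k * fst (turn X p), k * snd (turn X p)).
Proof. unfold turn; simpl; f_equal; ring. Qed.

(** The three half-turns carry [half a] to a positive multiple of [half d], so the form measures the
    total displacement. *)
Lemma qform_along (X Y Z : pt) (a b c d : R) : inD X -> inD Y -> inD Z ->
  a < b < a + 1 -> b < c < b + 1 -> c < d < c + 1 ->
  hgap X a b = 0 -> hgap Y b c = 0 -> hgap Z c d = 0 ->
  exists mu, 0 < mu /\ qform X Y Z (half a) = mu * sin (PI * (d - a)).
Proof.
intros HX HY HZ Hab Hbc Hcd E1 E2 E3.
destruct (turn_half X a b HX Hab E1) as [m1 [P1 T1]].
destruct (turn_half Y b c HY Hbc E2) as [m2 [P2 T2]].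
destruct (turn_half Z c d HZ Hcd E3) as [m3 [P3 T3]].
exists (m1 * m2 * m3); split; [now repeat apply Rmult_lt_0_compat|].
unfold qform.
rewrite T1, turn_scal, T2; cbn [fst snd].
rewrite <- !Rmult_assoc.
rewrite (turn_scal Z (half c) (m1 * m2)), T3, <- det_half.
unfold det; simpl; ring.
Qed.

Lemma qform_touches (X Y Z : pt) (F : R -> R) (t : R) :
  contact_lift X Y Z F -> touches X Y Z F t ->
  qform X Y Z (half t) = 0 /\ qform X Y Z (half (F t)) < 0.
Proof.
intros HC HT.
pose proof (touches_strict X Y Z F t HC HT) as [[S1 S2] [[S3 S4] [S5 S6]]].
destruct HT as [H0 [E0 [E1 E2]]].
destruct HC as [[HX [HY HZ]] [HF Hc]].
assert (Hw : forall t, t < F t < t + 1) by apply HF.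
split.
- destruct (qform_along X Y Z t (F t) (F (F t)) (F (F (F t)))) as [mu [_ ->]]; auto.
  replace (F (F (F t)) - t) with 1 by (unfold disp3 in H0; lra).
  rewrite Rmult_1_r, sin_PI; ring.
(* The involution through X takes the second point back to the first, one turn later. *)
- destruct (turn_half X (F t) (t + 1)) as [m [Pm Tm]].
  { exact HX. } { pose proof (Hw t). lra. }
  { rewrite hgap_shift_r. unfold hgap in *; rewrite bil_sym, E0; ring. }
  assert (Eq : qform X Y Z (half (F t))
               = m * bil Z (half (F t)) (turn Y (half (t + 1)))).
  { unfold qform. rewrite det_turn, Tm, turn_scal.
    unfold bil; simpl; ring. }
  rewrite Eq.
  assert (Hb : forall p, bil Z p (turn Y (half (t + 1))) = - bil Z p (turn Y (half t))).
  { intros p. unfold bil, turn, half; simpl.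
    replace (PI * (t + 1)) with (PI * t + PI) by ring. rewrite neg_cos, neg_sin; ring. }
  rewrite Hb.
  assert (S23 : 0 < sin (PI * (F (F t) - F t)))
    by (apply sin_PI_pos; pose proof (Hw (F t)); lra).
  (* Cramer's rule for [turn Y (half t)] in the basis [half (F t)], [half (F (F t))]; strict contact
     makes both terms positive. *)
  assert (E : bil Z (half (F t)) (turn Y (half t)) * sin (PI * (F (F t) - F t))
    = - hgap Y (F (F t)) t * hgap Z (F t) (F t)
      + hgap Y t (F t) * hgap Z (F t) (F (F t))).
  { rewrite <- det_half. unfold hgap, det, bil, turn; simpl; ring. }
  replace (F (F (F t))) with (t + 1) in S6 by (unfold disp3 in H0; lra).
  rewrite hgap_shift_r in S6.
  pose proof (hgap_diag_pos Z (F t) HZ).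
  assert (0 < - hgap Y (F (F t)) t * hgap Z (F t) (F t)) by now apply Rmult_lt_0_compat.
  assert (0 < hgap Y t (F t) * hgap Z (F t) (F (F t))) by now apply Rmult_lt_0_compat.
  assert (0 < bil Z (half (F t)) (turn Y (half t))) by nra.
  nra.
Qed.

Lemma locally_pos (f : R -> R) (x : R) : continuity f -> 0 < f x ->
  locally x (fun t => 0 < f t).
Proof.
intros Hf Hp.
apply filter_imp with (2 := proj1 (continuity_pt_locally f x) (Hf x) (mkposreal _ Hp)).
simpl; intros t Ht. apply Rabs_def2 in Ht. lra.
Qed.

(* Near a periodic point every step of the orbit pivots on a fixed vertex, so [F^3]
   coincides there with the composition of the three half-turns. *)
Lemma disp3_local_sign (X Y Z : pt) (F : R -> R) (t1 : R) :
  contact_lift X Y Z F -> touches X Y Z F t1 ->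
  locally t1 (fun t => (0 < qform X Y Z (half t) -> disp3 F t < 0) /\
                       (qform X Y Z (half t) < 0 -> 0 < disp3 F t)).
Proof.
intros HC HT.
pose proof (touches_strict X Y Z F t1 HC HT) as [[S1 S2] [[S3 S4] [S5 S6]]].
destruct HT as [H0 [E0 [E1 E2]]].
destruct HC as [[HX [HY HZ]] [HF Hc]].
assert (F0 : continuity (fun t : R => t)) by apply derivable_continuous, derivable_id.
assert (F1 : continuity F) by apply HF.
assert (F2 : continuity (fun t => F (F t))) by exact (continuity_comp F F F1 F1).
assert (F3 : continuity (fun t => F (F (F t)))) by exact (continuity_comp _ F F2 F1).
pose proof (continuity_disp3 F HF) as FD.
(* Untouched vertices stay strictly off each side, so contact must remain at the same vertex. *)
pose proof (locally_pos _ _ (continuity_hgap Y _ _ F0 F1) S1) as L1.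
pose proof (locally_pos _ _ (continuity_hgap Z _ _ F0 F1) S2) as L2.
pose proof (locally_pos _ _ (continuity_hgap X _ _ F1 F2) S3) as L3.
pose proof (locally_pos _ _ (continuity_hgap Z _ _ F1 F2) S4) as L4.
pose proof (locally_pos _ _ (continuity_hgap X _ _ F2 F3) S5) as L5.
pose proof (locally_pos _ _ (continuity_hgap Y _ _ F2 F3) S6) as L6.
(* In this range the sign of sin (pi x) is the sign of x. *)
assert (L7 : locally t1 (fun t => Rabs (disp3 F t) < 1)).
{ apply filter_imp with (2 := proj1 (continuity_pt_locally _ t1) (FD t1) (mkposreal 1 Rlt_0_1)).
  simpl; intros t Ht. now rewrite H0, Rminus_0_r in Ht. }
pose proof (filter_and _ _ L1 (filter_and _ _ L2 (filter_and _ _ L3 (filter_and _ _ L4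
  (filter_and _ _ L5 (filter_and _ _ L6 L7)))))) as L.
apply filter_imp with (2 := L).
intros t [P1 [P2 [P3 [P4 [P5 [P6 P7]]]]]].
assert (Hw : forall t, t < F t < t + 1) by apply HF.
destruct (qform_along X Y Z t (F t) (F (F t)) (F (F (F t)))) as [mu [Hmu ->]]; auto.
{ destruct (Hc t) as [_ C]; lra. }
{ destruct (Hc (F t)) as [_ C]; lra. }
{ destruct (Hc (F (F t))) as [_ C]; lra. }
apply Rabs_def2 in P7.
replace (F (F (F t)) - t) with (disp3 F t + 1) by (unfold disp3; ring).
replace (PI * (disp3 F t + 1)) with (PI * disp3 F t + PI) by ring.
rewrite neg_sin.
split; intros Hs.
- destruct (Rlt_le_dec (disp3 F t) 0) as [L'|L']; [exact L'|exfalso].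
  assert (0 <= sin (PI * disp3 F t)) by (apply sin_PI_ge0; lra). nra.
- destruct (Rlt_le_dec 0 (disp3 F t)) as [L'|L']; [exact L'|exfalso].
  assert (0 <= sin (PI * (- disp3 F t))) by (apply sin_PI_ge0; lra).
  rewrite Ropp_mult_distr_r_reverse, sin_neg in *. nra.
Qed.

(** * Sign of the displacement between periodic points *)

Lemma locally_right (P : R -> Prop) (x y : R) : locally x P -> x < y ->
  exists t, x < t < y /\ P t.
Proof.
intros [ep H] Hxy. pose proof (cond_pos ep) as Hep.
pose proof (Rmin_l ep (y - x)). pose proof (Rmin_r ep (y - x)).
assert (0 < Rmin ep (y - x)) by (apply Rmin_glb_lt; lra).
exists (x + Rmin ep (y - x) / 2); split; [lra|].
apply H. change (Rabs (x + Rmin ep (y - x) / 2 - x) < ep).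
rewrite Rabs_pos_eq; lra.
Qed.

Lemma locally_left (P : R -> Prop) (x y : R) : locally x P -> y < x ->
  exists t, y < t < x /\ P t.
Proof.
intros [ep H] Hxy. pose proof (cond_pos ep) as Hep.
pose proof (Rmin_l ep (x - y)). pose proof (Rmin_r ep (x - y)).
assert (0 < Rmin ep (x - y)) by (apply Rmin_glb_lt; lra).
exists (x - Rmin ep (x - y) / 2); split; [lra|].
apply H. change (Rabs (x - Rmin ep (x - y) / 2 - x) < ep).
rewrite Rabs_left; lra.
Qed.

(** Both orientations yield the same form by [qform_rev], so they need not be distinguished any
    more. *)
Lemma exists_fixed_direction (P Q R0 : pt) (F : R -> R) (t : R) :
  contact_lift P Q R0 F -> disp3 F t = 0 ->
  exists t', (t' = t \/ t' = F t \/ t' = F (F t)) /\ disp3 F t' = 0 /\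
    qform P Q R0 (half t') = 0 /\ qform P Q R0 (half (F t')) < 0 /\
    locally t' (fun s => (0 < qform P Q R0 (half s) -> disp3 F s < 0) /\
                         (qform P Q R0 (half s) < 0 -> 0 < disp3 F s)).
Proof.
intros HC H0.
destruct (exists_touches P Q R0 F t HC H0) as [t' [Ht' [HT|HT]]];
  exists t'; split; try exact Ht'; (split; [apply HT|]).
- destruct (qform_touches P Q R0 F t' HC HT).
  split; [assumption|split; [assumption|now apply disp3_local_sign]].
- apply contact_lift_swap in HC.
  destruct (qform_touches R0 Q P F t' HC HT) as [E1 E2].
  rewrite qform_rev in E1, E2.
  split; [assumption|split; [assumption|]].
  apply filter_imp with (2 := disp3_local_sign R0 Q P F t' HC HT).
  intros s; now rewrite qform_rev.
Qed.

Lemma orbit_order (F : R -> R) (t1 r : R) : circle_lift F -> disp3 F t1 = 0 ->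
  t1 < r < F t1 ->
  (t1 < r < F t1) /\ (F t1 < F r < F (F t1)) /\ (F (F t1) < F (F r) < t1 + 1).
Proof.
intros [_ [Hm _]] H0 Hr; unfold disp3 in H0.
assert (F t1 < F r < F (F t1)) by (split; apply Hm; lra).
assert (F (F t1) < F (F r) < F (F (F t1))) by (split; apply Hm; lra).
repeat split; lra.
Qed.

(** With [be] = 0 the form is [ga] sin^2, and its value at [F t1] makes [ga] negative. It has no
    other zero within the turn, hence there is no other periodic orbit. *)
Lemma rising_of_parabolic (P Q R0 : pt) (F : R -> R) (t : R) :
  contact_lift P Q R0 F -> disp3 F t = 0 ->
  cross P Q R0 ^ 2 = normdef P * normdef Q * normdef R0 ->
  exists t1, rising F t1 (F t1).
Proof.
intros HC H0 HX.
destruct (exists_fixed_direction P Q R0 F t HC H0) as [t1 [_ [H1 [Q1 [Q2 L]]]]].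
exists t1. pose proof (proj1 (proj2 HC)) as HF.
destruct (qform_expand P Q R0 t1 Q1) as [be [ga [Hb Hq]]].
assert (be = 0) by (rewrite HX in Hb; nra). subst be.
assert (Hw : forall t, t < F t < t + 1) by apply HF.
pose proof (Hw t1) as Hw1. pose proof (Hw (F t1)) as Hw2.
pose proof (Hw (F (F t1))) as Hw3.
assert (Hga : ga < 0).
{ rewrite Hq in Q2. assert (0 < sin (PI * (F t1 - t1))) by (apply sin_PI_pos; lra).
  set (k := sin (PI * (F t1 - t1))) in *.
  destruct (Rlt_le_dec ga 0) as [A|A]; [exact A|exfalso].
  assert (0 <= k * (ga * k)) by (repeat apply Rmult_le_pos; lra). lra. }
assert (Hneg : forall r, t1 < r < t1 + 1 -> qform P Q R0 (half r) < 0).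
{ intros r Hr; rewrite Hq. assert (0 < sin (PI * (r - t1))) by (apply sin_PI_pos; lra).
  set (k := sin (PI * (r - t1))) in *.
  assert (0 < k * (- ga * k)) by (repeat apply Rmult_lt_0_compat; lra). lra. }
split; [lra|split; [exact H1|split; [now apply disp3_sign_step|]]].
destruct (locally_right _ t1 (F t1) L) as [x [Hx [_ Ex]]]; [lra|].
apply (pos_of_no_zero (disp3 F) t1 (F t1) x); [now apply continuity_disp3| |exact Hx|].
- intros r Hr Er.
  destruct (exists_fixed_direction P Q R0 F r HC Er) as [r' [Hr' [_ [Qr _]]]].
  pose proof (orbit_order F t1 r HF H1 Hr).
  assert (qform P Q R0 (half r') < 0); [|lra].
  apply Hneg. unfold disp3 in H1. destruct Hr' as [->|[->| ->]]; lra.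
- apply Ex, Hneg; lra.
Qed.

(** F carries y into the arc of x and keeps the sign, so a sign change across t1 becomes one inside
    a single arc. *)
Lemma second_zero (F : R -> R) (t1 x y : R) : circle_lift F -> disp3 F t1 = 0 ->
  t1 < x < F t1 -> F (F t1) - 1 < y < t1 ->
  (disp3 F x < 0 < disp3 F y \/ disp3 F y < 0 < disp3 F x) ->
  exists s, t1 < s < F t1 /\ disp3 F s = 0.
Proof.
intros HF H0 Hx Hy Hs.
destruct (disp3_sign_step F y HF) as [_ [Y1 Y2]].
assert (HFy : t1 < F y < F t1).
{ destruct HF as [_ [Hm [Hp _]]]; split; [|now apply Hm].
  assert (A : F (F (F t1) - 1) < F y) by now apply Hm.
  pose proof (Hp (F (F t1) - 1)) as B.
  replace (F (F t1) - 1 + 1) with (F (F t1)) in B by ring.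
  unfold disp3 in H0; lra. }
pose proof (continuity_disp3 F HF) as Hc.
destruct (Rle_dec x (F y)) as [L|L].
- destruct (ivt_between (disp3 F) x (F y) 0 Hc L) as [s [Hs1 Hs2]]; [lra|].
  exists s; split; [lra|exact Hs2].
- destruct (ivt_between (disp3 F) (F y) x 0 Hc) as [s [Hs1 Hs2]]; [lra|lra|].
  exists s; split; [lra|exact Hs2].
Qed.

Lemma lift_inj (F : R -> R) (x y : R) : circle_lift F -> F x = F y -> x = y.
Proof.
intros [_ [Hm _]] E.
destruct (Rtotal_order x y) as [H|[H|H]]; [|exact H|]; apply Hm in H; lra.
Qed.

(** Without its sine factor the form is linear, with one zero direction as [be] is nonzero; both
    orbits must contain it. *)
Lemma zero_unique (P Q R0 : pt) (F : R -> R) (t1 r s be ga : R) :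
  contact_lift P Q R0 F -> disp3 F t1 = 0 -> be <> 0 ->
  (forall t, qform P Q R0 (half t) =
      sin (PI * (t - t1)) * (be * cos (PI * (t - t1)) + ga * sin (PI * (t - t1)))) ->
  t1 < r < F t1 -> t1 < s < F t1 -> disp3 F r = 0 -> disp3 F s = 0 -> r = s.
Proof.
intros HC H0 Hbe Hq Hr Hs Er Es. pose proof (proj1 (proj2 HC)) as HF.
destruct (exists_fixed_direction P Q R0 F r HC Er) as [r' [Hr' [_ [Qr _]]]].
destruct (exists_fixed_direction P Q R0 F s HC Es) as [s' [Hs' [_ [Qs _]]]].
pose proof (orbit_order F t1 r HF H0 Hr) as Or.
pose proof (orbit_order F t1 s HF H0 Hs) as Os.
assert (Br : t1 < r' < t1 + 1) by (destruct Hr' as [->|[->| ->]]; lra).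
assert (Bs : t1 < s' < t1 + 1) by (destruct Hs' as [->|[->| ->]]; lra).
assert (Z : forall x, t1 < x < t1 + 1 -> qform P Q R0 (half x) = 0 ->
  be * cos (PI * (x - t1)) + ga * sin (PI * (x - t1)) = 0).
{ intros x Hx E; rewrite Hq in E.
  assert (0 < sin (PI * (x - t1))) by (apply sin_PI_pos; lra).
  apply Rmult_integral in E; lra. }
apply (Z _ Br) in Qr. apply (Z _ Bs) in Qs.
assert (E : sin (PI * (r' - s')) = 0).
{ replace (PI * (r' - s')) with (PI * (r' - t1) - PI * (s' - t1)) by ring.
  rewrite sin_minus.
  set (c1 := cos (PI * (r' - t1))) in *; set (l1 := sin (PI * (r' - t1))) in *.
  set (c2 := cos (PI * (s' - t1))) in *; set (l2 := sin (PI * (s' - t1))) in *.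
  apply Rmult_eq_reg_l with be; [|exact Hbe].
  transitivity ((be * c2 + ga * l2) * l1 - (be * c1 + ga * l1) * l2); [ring|].
  rewrite Qr, Qs; ring. }
assert (E' : r' = s').
{ destruct (sin_eq_0_0 _ E) as [k Hk]. pose proof PI_RGT_0.
  assert (Hk' : r' - s' = IZR k) by (apply Rmult_eq_reg_l with PI; lra).
  pose proof (IZR_small k). lra. }
(* The three arcs of the orbit of t1 are disjoint, so the common point is the same iterate of r and
   of s. *)
destruct Hr' as [->|[->| ->]], Hs' as [->|[->| ->]]; try lra.
- now apply (lift_inj F).
- now apply (lift_inj F), (lift_inj F).
Qed.

Lemma attracting_of_hyperbolic (P Q R0 : pt) (F : R -> R) (t : R) :
  contact_lift P Q R0 F -> disp3 F t = 0 ->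
  normdef P * normdef Q * normdef R0 < cross P Q R0 ^ 2 ->
  exists s0 t0, rising F s0 t0 /\ falling F t0 (F s0).
Proof.
intros HC H0 HX.
destruct (exists_fixed_direction P Q R0 F t HC H0) as [t1 [_ [H1 [Q1 [_ L]]]]].
pose proof (proj1 (proj2 HC)) as HF.
destruct (qform_expand P Q R0 t1 Q1) as [be [ga [Hb Hq]]].
assert (Hbe : be <> 0) by (intros ->; nra).
assert (Hw : forall t, t < F t < t + 1) by apply HF.
pose proof (Hw t1) as Hw1. pose proof (Hw (F t1)) as Hw2.
pose proof (Hw (F (F t1))) as Hw3.
pose proof (continuity_disp3 F HF) as Hc.
(* Multiplying by [be] treats both signs of the derivative at t1 at once. *)
assert (Hlin : locally t1 (fun t => 0 < be * (be * cos (PI * (t - t1)) + ga * sin (PI * (t - t1))))).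
{ apply (locally_pos (fun t => be * (be * cos (PI * (t - t1)) + ga * sin (PI * (t - t1))))).
  - apply derivable_continuous; reg.
  - replace (PI * (t1 - t1)) with 0 by ring. rewrite cos_0, sin_0. nra. }
assert (Hloc : locally t1 (fun t =>
  (t1 < t < t1 + 1 -> be * disp3 F t < 0) /\ (t1 - 1 < t < t1 -> 0 < be * disp3 F t))).
{ apply filter_imp with (2 := filter_and _ _ L Hlin).
  intros x [[A1 A2] A3]; rewrite Hq in A1, A2.
  set (l := be * cos (PI * (x - t1)) + ga * sin (PI * (x - t1))) in *.
  split; intros Hx.
  - assert (S : 0 < sin (PI * (x - t1))) by (apply sin_PI_pos; lra).
    destruct (Rlt_le_dec 0 be) as [B|B].
    + assert (0 < l) by nra. assert (disp3 F x < 0) by (apply A1; nra). nra.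
    + assert (l < 0) by nra. assert (0 < disp3 F x) by (apply A2; nra). nra.
  - assert (S : 0 < sin (PI * (t1 - x))) by (apply sin_PI_pos; lra).
    replace (PI * (t1 - x)) with (- (PI * (x - t1))) in S by ring.
    rewrite sin_neg in S.
    destruct (Rlt_le_dec 0 be) as [B|B].
    + assert (0 < l) by nra. assert (0 < disp3 F x) by (apply A2; nra). nra.
    + assert (l < 0) by nra. assert (disp3 F x < 0) by (apply A1; nra). nra. }
unfold disp3 in H1.
assert (Hz : exists s, t1 < s < F t1 /\ disp3 F s = 0).
{ destruct (locally_right _ t1 (F t1) Hloc) as [x [Hx [Ex _]]]; [lra|].
  destruct (locally_left _ t1 (F (F t1) - 1) Hloc) as [y [Hy [_ Ey]]]; [lra|].
  specialize (Ex ltac:(lra)). specialize (Ey ltac:(lra)).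
  apply (second_zero F t1 x y HF); [unfold disp3; lra|exact Hx|exact Hy|].
  destruct (Rlt_le_dec 0 be); [left|right]; split; nra. }
destruct Hz as [s [Hs Es]].
assert (H1' : disp3 F t1 = 0) by (unfold disp3; lra).
assert (Hu : forall r, t1 < r < F t1 -> r <> s -> disp3 F r <> 0).
{ intros r Hr Hn Er; apply Hn.
  now apply (zero_unique P Q R0 F t1 r s be ga). }
pose proof (orbit_order F t1 s HF H1' Hs) as [_ [Os1 Os2]].
(* The point of the orbit of s that precedes t1, with F y = s. *)
set (y := F (F s) - 1).
assert (Fy : F y = s).
{ pose proof (proj1 (proj2 (proj2 HF)) y) as B. unfold y at 1 in B.
  replace (F (F s) - 1 + 1) with (F (F s)) in B by ring. unfold disp3 in Es; lra. }
assert (Hy : t1 - 1 < y < t1) by (unfold y; lra).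
assert (Ey : disp3 F y = 0).
{ unfold y. replace (F (F s) - 1) with (F (F s) + IZR (-1)) by (simpl; lra).
  rewrite disp3_periodic by exact HF. now apply disp3_sign_step, disp3_sign_step. }
assert (Zr : forall r, t1 < r < s -> disp3 F r <> 0) by (intros r Hr; apply Hu; lra).
assert (Zl : forall r, y < r < t1 -> disp3 F r <> 0).
{ intros r Hr Er. assert (A : s < F r < F t1).
  { rewrite <- Fy. destruct HF as [_ [Hm _]]; split; apply Hm; lra. }
  apply (Hu (F r)); [lra|lra|now apply disp3_sign_step]. }
destruct (locally_right _ t1 s Hloc) as [x [Hx [Ex _]]]; [lra|].
destruct (locally_left _ t1 y Hloc) as [z [Hzy [_ Ez]]]; [lra|].
specialize (Ex ltac:(lra)). specialize (Ez ltac:(lra)).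
(* For [be] > 0 the point t1 attracts and y repels; otherwise t1 repels and s attracts. *)
destruct (Rlt_le_dec 0 be) as [B|B].
- exists y, t1. rewrite Fy; split.
  + split; [lra|split; [exact Ey|split; [exact H1'|]]].
    apply (pos_of_no_zero (disp3 F) y t1 z); try assumption; nra.
  + split; [lra|split; [exact H1'|split; [exact Es|]]].
    apply (neg_of_no_zero (disp3 F) t1 s x); try assumption; nra.
- exists t1, s; split.
  + split; [lra|split; [exact H1'|split; [exact Es|]]].
    apply (pos_of_no_zero (disp3 F) t1 s x); try assumption; nra.
  + rewrite <- Fy at 1. apply falling_step; [exact HF|].
    split; [lra|split; [exact Ey|split; [exact H1'|]]].
    apply (neg_of_no_zero (disp3 F) y t1 z); try assumption; nra.
Qed.

Theorem theorem4p4 (P Q R0 : pt) (psi : pt -> pt) :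
  inD P -> inD Q -> inD R0 -> noncollinear P Q R0 ->
  (forall v, onS1 v -> is_psi P Q R0 v (psi v)) ->
  rotation_number_is psi (1 / 3) ->
  (is_delta P Q R0 (Deltaprime P Q) ->
     exists u1, onS1 u1 /\ Nat.iter 3 psi u1 = u1 /\
       let u2 := psi u1 in let u3 := psi (psi u1) in
       (forall v, in_arc u3 u1 v -> v <> u3 -> conv3 psi v u1) /\
       (forall v, in_arc u1 u2 v -> v <> u1 -> conv3 psi v u2) /\
       (forall v, in_arc u2 u3 v -> v <> u2 -> conv3 psi v u3)) /\
  (forall m, is_delta P Q R0 m -> m > Deltaprime P Q ->
     exists u1, onS1 u1 /\ Nat.iter 3 psi u1 = u1 /\
       let u2 := psi u1 in let u3 := psi (psi u1) in
       exists v1, in_arc u1 u2 v1 /\ v1 <> u1 /\ v1 <> u2 /\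
         Nat.iter 3 psi v1 = v1 /\
         let v2 := psi v1 in let v3 := psi (psi v1) in
         (forall v, in_arc v3 v1 v -> v <> v3 -> v <> v1 -> conv3 psi v u1) /\
         (forall v, in_arc v1 v2 v -> v <> v1 -> v <> v2 -> conv3 psi v u2) /\
         (forall v, in_arc v2 v3 v -> v <> v2 -> v <> v3 -> conv3 psi v u3)).
Proof.
intros HP HQ HR HN Hpsi [F [Fc [FL [F0 Flim]]]].
pose proof (contact_lift_of_psi P Q R0 psi F HP HQ HR Hpsi Fc FL F0) as HC.
pose proof (proj1 (proj2 HC)) as HF.
destruct (disp3_zero_of_rotation F HF Flim) as [t Ht].
split.
- intros Hd.
  destruct (rising_of_parabolic P Q R0 F t HC Ht) as [t1 H1]; [now apply delta_eq_cross|].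
  now apply (conv3_semistable F psi t1).
- intros m Hd Hm.
  destruct (attracting_of_hyperbolic P Q R0 F t HC Ht) as [s0 [t0 [H1 H2]]];
    [now apply (delta_gt_cross P Q R0 m)|].
  now apply (conv3_attracting F psi s0 t0).
Qed.
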